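(* Let $T>0$, $D=(-1,1)$, and let $Q=[\beta_0,\beta_1]\times[\alpha_0,\alpha_1]\times[\gamma_0,\gamma_1]$ with $\beta_0,\alpha_0,\gamma_0>0$, $\alpha_1,\gamma_1<2$ and $\beta_1<1$. Let $f\in L^2(D)$ belong to $\dot H^{\alpha,\gamma}$ for all $(\alpha,\gamma)\in[\alpha_0,\alpha_1]\times[\gamma_0,\gamma_1]$, and let $\varphi\in L^2(0,T]$. For $a=(\beta,\alpha,\gamma)\in Q$ let $u(a)$ be the weak solution of $$\begin{cases}\partial_t^\beta u(t,x)=-(-\Delta)^{\alpha/2}u(t,x)-(-\Delta)^{\gamma/2}u(t,x), & 0<t<T,\ -1<x<1,\\ u(t,1)=u(t,-1)=0, & 0<t<T,\\ u(0,x)=f(x), & -1<x<1,\end{cases}$$ and set $$I(a)=\|u(a)(t,0)-\varphi(t)\|_{L^2(0,T]}^2 .$$ Then there exists $a^*=(\beta^*,\alpha^*,\gamma^* )\in Q$ such that $I(a^* )\le I(a)$ for all $a\in Q$.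
   Context: Caputo derivative, for $0<\beta<1$: $\partial_t^\beta q(t)=\frac{1}{\Gamma(1-\beta)}\int_0^t \frac{\partial q(s)}{\partial s}\frac{ds}{(t-s)^\beta}$. Mittag-Leffler function: $E_\beta(z)=\sum_{k\ge0}\frac{z^k}{\Gamma(\beta k+1)}$. Dirichlet eigenpairs of $-\Delta$ on $D=(-1,1)$: $\bar\mu_n=(n\pi/2)^2$, $\psi_n(x)=\sin\big[\tfrac{n\pi}{2}(x+1)\big]$, $n\ge1$; $(\psi_n)$ is an orthonormal basis of $L^2(D)$, and $\langle\cdot,\cdot\rangle$ is the inner product of $L^2(D)$. Put $\mu_n=\bar\mu_n^{\alpha/2}+\bar\mu_n^{\gamma/2}$. The space $\dot H^{\alpha,\gamma}$ is $\{v\in L^2(D):\sum_{n\ge1}\mu_n^2\langle v,\psi_n\rangle^2<\infty\}$, with norm $\big(\sum_{n\ge1}\mu_n^2\langle v,\psi_n\rangle^2\big)^{1/2}$. The operator $\mathtt L_D^{\alpha,\gamma}:=-(-\Delta)^{\alpha/2}-(-\Delta)^{\gamma/2}$ is defined spectrally by $\mathtt L_D^{\alpha,\gamma}v=-\sum_{n\ge1}\mu_n\langle v,\psi_n\rangle\psi_n$. Weak solution: $u(t,\cdot)\in\dot H^{\alpha,\gamma}$ for each $t>0$; $u(t,\cdot)=0$ on $\partial D$ for $0<t\le T$; $\lim_{t\downarrow0}u(t,x)=f(x)$ a.e.; $\partial_t^\beta u(t,\cdot)=\mathtt L_D^{\alpha,\gamma}u(t,\cdot)$ in $L^2(D)$.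 The unique weak solution is given by the expansion $u(t,x)=\sum_{n\ge1}E_\beta(-\mu_nt^\beta)\langle f,\psi_n\rangle\psi_n(x)$, and $u(t,0)$ denotes the value of this series at $x=0$. The map $a\mapsto u(a)(\cdot,0)$ is taken to be a well-defined map from $Q$ into $L^2(0,T]$, the usual $L^2$ space on the time interval. *)

(* Defs.v *)
From HB Require Import structures.
From mathcomp Require Import all_boot all_order all_algebra.
From mathcomp Require Import all_classical all_reals all_analysis.

Set Implicit Arguments.
Unset Strict Implicit.
Unset Printing Implicit Defensive.
Import Order.TTheory GRing.Theory Num.Theory.
Import numFieldNormedType.Exports.
Local Open Scope classical_set_scope.
Local Open Scope ring_scope.

Section SpecialFunctions.
Context {R : realType}.

(* Only meaningful for [0 < z], where the Lebesgue integral converges. *)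
Definition Gamma (z : R) : R :=
  \int[lebesgue_measure]_(s in `]0, +oo[) (s `^ (z - 1) * expR (- s)).

Definition mittag_leffler (b z : R) : R :=
  limn (series (fun k : nat => z ^+ k / Gamma (b * k%:R + 1))).

(* [q] has Caputo derivative [c] of order [b] at time [t]. *)
Definition is_caputo (b : R) (q : R -> R) (t c : R) : Prop :=
  [/\ forall s, 0 < s < t -> derivable q s 1,
      lebesgue_measure.-integrable `]0, t[
        (fun s => (derive1 q s / (t - s) `^ b)%:E) &
      c = (Gamma (1 - b))^-1 *
          \int[lebesgue_measure]_(s in `]0, t[) (derive1 q s / (t - s) `^ b)].

End SpecialFunctions.

Section SquareIntegrable.
Context {R : realType}.
Implicit Types (A : set R) (v w : R -> R).

(* Square-integrable functions on [A] are represented by total functions whose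
   values outside [A] are irrelevant. *)
Definition L2 A v : Prop :=
  measurable_fun A v /\
  lebesgue_measure.-integrable A (fun x => (v x ^+ 2)%:E).

Definition L2_inner A v w : R :=
  \int[lebesgue_measure]_(x in A) (v x * w x).

Definition L2_norm A v : R := Num.sqrt (L2_inner A v v).

(* [w = \sum_(n >= 1) g n] with convergence in the norm of [L2 A]; [L2_norm] is
   a total function, so this is only to be used with every [g n] in [L2 A]. *)
Definition L2_series A (g : nat -> R -> R) w : Prop :=
  L2 A w /\
  L2_norm A (fun x => w x - \sum_(1 <= n < N.+1) g n x) @[N --> \oo] --> 0.

End SquareIntegrable.

Section FractionalDiffusion.
Context {R : realType}.
Implicit Types (al ga : R) (v w f : R -> R).

Definition Dom : set R := `]-1, 1[.

Definition psi (n : nat) (x : R) : R := sin (n%:R * pi / 2 * (x + 1)).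

Definition mu_bar (n : nat) : R := (n%:R * pi / 2) ^+ 2.

Definition mu al ga (n : nat) : R :=
  mu_bar n `^ (al / 2) + mu_bar n `^ (ga / 2).

Definition coef v (n : nat) : R := L2_inner Dom v (psi n).

Definition Hdot al ga v : Prop :=
  L2 Dom v /\
  (\sum_(1 <= n <oo) ((mu al ga n) ^+ 2 * (coef v n) ^+ 2)%:E < +oo)%E.

(* [w] is (a representative of) the image of [v] under
   [- (-Delta)^(al/2) - (-Delta)^(ga/2)]. *)
Definition is_LD al ga v w : Prop :=
  L2_series Dom (fun n x => - (mu al ga n * coef v n * psi n x)) w.

(* A parameter is a triple [a = (beta, alpha, gamma)]. *)
Definition weak_solution (T : R) f (a : R * R * R) (u : R -> R -> R) : Prop :=
  let: (b, al, ga) := a in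
  [/\ forall t, 0 < t <= T -> Hdot al ga (u t),
      forall t, 0 < t <= T -> u t (-1) = 0 /\ u t 1 = 0,
      {ae lebesgue_measure, forall x, Dom x -> u t x @[t --> 0^'+] --> f x} &
      forall t, 0 < t < T -> exists2 w, is_LD al ga (u t) w &
        {ae lebesgue_measure, forall x, Dom x ->
           is_caputo b (fun s => u s x) t (w x)}].

Definition expansion_term f (a : R * R * R) (t : R) (n : nat) (x : R) : R :=
  let: (b, al, ga) := a in
  mittag_leffler b (- mu al ga n * t `^ b) * coef f n * psi n x.

Definition param_box (b0 b1 al0 al1 ga0 ga1 : R) : set (R * R * R) :=
  [set a | [/\ b0 <= a.1.1 <= b1, al0 <= a.1.2 <= al1 & ga0 <= a.2 <= ga1]].

Definition misfit (T : R) (phi : R -> R) (u : R -> R -> R) : R :=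
  L2_norm `]0, T] (fun t => u t 0 - phi t) ^+ 2.

End FractionalDiffusion.

(* Main.v *)
Require Import Defs.
From HB Require Import structures.
From mathcomp Require Import all_boot all_order all_algebra.
From mathcomp Require Import all_classical all_reals all_analysis.
From mathcomp Require Import measurable_realfun ring lra zify.
Import Order.TTheory GRing.Theory Num.Theory.
Import numFieldNormedType.Exports.
Local Open Scope classical_set_scope.
Local Open Scope ring_scope.

(** Why a minimiser exists.

    The box of parameters is compact, so a misfit that is sequentially lower
    semicontinuous on it attains its infimum ([compact_lsc_min]).  By Fatou's
    lemma ([L2_norm_fatou]) lower semicontinuity follows once [u(a)(t, 0)]
    depends continuously on [a] for almost every [t].

    Write [u(a)(t, 0) = sum_n E_b(- x_n) c_n], where [E_b] is the Mittag-Leffler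
    function, [x_n = mu_n t^b] and [c_n = <f, psi_n> psi_n(0)].  For small
    exponents [al], [ga] this series need not converge absolutely, so that
    continuity cannot come from dominating its terms.  It is compared instead,
    by summation by parts, with the series of the least parameter
    [a0 = (b0, al0, ga0)] at one time [s] at which that series converges.  The
    terms differ by the factor [E_b(- x_n) / E_b0(- x0_n)], whose total
    variation in [n] is bounded uniformly in [a] ([variation_le_mode_ratio]);
    hence the tails are uniformly small and the sum is continuous in [a]
    ([abel_cvg], [mode_series_cvg]).

    The bound on the variation rests on one property of the Mittag-Leffler
    function: [x E_b(- x)] is a Lipschitz function of [1 / x], with a constant
    that is uniform for [b <= b1 < 1] ([mittag_leffler_lipschitz]).  It is also
    bounded, and bounded away from 0 for large [x] ([mittag_leffler_upper],
    [mittag_leffler_lower]).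

    These facts are proved by discretisation, without complex analysis.  Put
    [A = (1 - z)^(- b)].  Then [E_b(- x)] is the limit, for [l = x / n^b], of
    the coefficient of [z^n] in [(1 - z)^(- 1) / (1 + l A)] ([scheme_cvg]): the
    partial sums of the expansion in powers of [l] alternate around this
    coefficient ([surv_expansion_le]), and the coefficient of [z^n] in
    [(1 - z)^(- 1 - b k)] is equivalent to [n^(b k) / Gamma(1 + b k)] by
    Euler's limit ([risc_cvg]).  For power series the estimates are algebra.
    The series [P = l A / (1 + l A)] has nonnegative coefficients because those
    of [A] are log-convex (Kaluza's argument, [wait_ge0]); the equation
    [(1 - z) P' = b P (1 - P)] shows that they decrease ([wait_decr]); and
    [l / (1 + l A) - l' / (1 + l' A) = (l - l') / ((1 + l A) (1 + l' A))]
    reduces the Lipschitz estimate to a bound on the coefficients of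
    [(1 - z)^(- 1) / ((1 + l A) (1 + l' A))] ([conv_surv_resolvent_le]). *)

Set Implicit Arguments.
Unset Strict Implicit.
Unset Printing Implicit Defensive.

(** * Power series as sequences of coefficients *)

Section Cauchy.
Context {F : comNzRingType}.
Implicit Types f g h : nat -> F.

Definition conv f g (n : nat) : F := \sum_(i < n.+1) f i * g (n - i)%N.

Definition delta (n : nat) : F := (n == 0%N)%:R.

(** Up to order [n] a Cauchy product is a product of truncations, so that the
    ring laws of polynomials pass to power series. *)
Lemma conv_poly f g n m : (n < m)%N ->
  conv f g n = (\poly_(i < m) f i * \poly_(i < m) g i)`_n.
Proof.
move=> nm; rewrite coefM; apply: eq_bigr => i _.
rewrite !coef_poly (leq_ltn_trans (leq_subr i n) nm).
by rewrite (leq_trans (ltn_ord i) nm).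
Qed.

Lemma eq_conv f f' g g' n : (forall i, (i <= n)%N -> f i = f' i) ->
  (forall i, (i <= n)%N -> g i = g' i) -> conv f g n = conv f' g' n.
Proof.
move=> ff' gg'; apply: eq_bigr => i _.
by rewrite ff' ?gg' ?leq_subr // -ltnS.
Qed.

Lemma convC f g n : conv f g n = conv g f n.
Proof. by rewrite !(@conv_poly _ _ n n.+1) // mulrC. Qed.

Lemma convA f g h n : conv f (conv g h) n = conv (conv f g) h n.
Proof.
have trunc p k : (k <= n)%N -> (\poly_(i < n.+1) p`_i : {poly F})`_k = p`_k.
  by move=> kn; rewrite coef_poly ltnS kn.
rewrite (@eq_conv f f _
  (nth 0 (\poly_(i < n.+1) g i * \poly_(i < n.+1) h i)) n) //; last first.
  by move=> i i_n; rewrite -conv_poly.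
rewrite (@eq_conv (conv f g)
  (nth 0 (\poly_(i < n.+1) f i * \poly_(i < n.+1) g i)) h h n) //; last first.
  by move=> i i_n; rewrite -conv_poly.
rewrite [LHS](@conv_poly _ _ n n.+1) // [RHS](@conv_poly _ _ n n.+1) //.
set p := \poly_(i < n.+1) f i; set q := \poly_(i < n.+1) g i.
set r := \poly_(i < n.+1) h i.
transitivity ((p * (q * r))`_n).
  rewrite !coefM; apply: eq_bigr => i _; congr (_ * _).
  by rewrite trunc // leq_subr.
rewrite mulrA !coefM; apply: eq_bigr => i _; congr (_ * _).
by rewrite trunc // -ltnS.
Qed.

Lemma convDl f f' g n :
  conv (fun i => f i + f' i) g n = conv f g n + conv f' g n.
Proof. by rewrite -big_split; apply: eq_bigr => i _; rewrite mulrDl. Qed.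

Lemma convBl f f' g n : conv (fun i => f i - f' i) g n = conv f g n - conv f' g n.
Proof. by rewrite -sumrB; apply: eq_bigr => i _; rewrite mulrBl. Qed.

Lemma convZl c f g n : conv (fun i => c * f i) g n = c * conv f g n.
Proof. by rewrite mulr_sumr; apply: eq_bigr => i _; rewrite mulrA. Qed.

Lemma convDr f g g' n : conv f (fun i => g i + g' i) n = conv f g n + conv f g' n.
Proof. by rewrite convC convDl !(convC _ f). Qed.

Lemma convBr f g g' n : conv f (fun i => g i - g' i) n = conv f g n - conv f g' n.
Proof. by rewrite convC convBl !(convC _ f). Qed.

Lemma convZr c f g n : conv f (fun i => c * g i) n = c * conv f g n.
Proof. by rewrite convC convZl (convC _ f). Qed.

Lemma conv_delta f n : conv delta f n = f n.
Proof.
rewrite /conv big_ord_recl /delta mul1r subn0 big1 ?addr0 // => i _.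
by rewrite mul0r.
Qed.

(** The derivation [(1 - z) d/dz].  The binomial series [(1 - z)^(- a)] are its
    eigenvectors, which turns identities between them into linear algebra. *)
Definition euler f (n : nat) : F := n.+1%:R * f n.+1 - n%:R * f n.

Lemma euler_conv f g n : euler (conv f g) n = conv (euler f) g n + conv f (euler g) n.
Proof.
(* Both terms of [(n + 1) f_(n+1) - n f_n] split along [n = i + (n - i)]. *)
have shift h k n' : \sum_(i < n'.+2) i%:R * h i * k (n'.+1 - i)%N =
    \sum_(i < n'.+1) i.+1%:R * h i.+1 * k (n' - i)%N :> F.
  by rewrite big_ord_recl !mul0r add0r; apply: eq_bigr => i _; rewrite subSS.
have D n' : n'%:R * conv f g n' = conv (fun i => i%:R * f i) g n' +
                                conv (fun i => i%:R * g i) f n'.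
  rewrite (convC _ f) -big_split mulr_sumr; apply: eq_bigr => i _ /=.
  have {1}-> : n' = (i + (n' - i))%N by rewrite subnKC // -ltnS.
  by rewrite natrD; ring.
rewrite (convC f (euler g)) /euler !convBl !D.
rewrite [conv (fun i => i%:R * f i) g n.+1]shift.
rewrite [conv (fun i => i%:R * g i) f n.+1]shift.
by rewrite /conv; ring.
Qed.

End Cauchy.

(** * Coefficients of binomial series *)

Section RisingCoefficients.
Context {F : realFieldType}.
Implicit Types a b : F.

(** The coefficient of [z^n] in [(1 - z)^(- a)]. *)
Definition risc a (n : nat) : F := \prod_(j < n) ((a + j%:R) / j.+1%:R).

Lemma risc0 a : risc a 0 = 1.
Proof. by rewrite /risc big_ord0. Qed.

Lemma riscS a n : risc a n.+1 = risc a n * ((a + n%:R) / n.+1%:R).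
Proof. by rewrite /risc big_ord_recr. Qed.

Lemma natS_neq0 n : n.+1%:R != 0 :> F.
Proof. by rewrite pnatr_eq0. Qed.

Lemma euler_risc a n : euler (risc a) n = a * risc a n.
Proof. by rewrite /euler riscS; field; rewrite nat1r natS_neq0. Qed.

Lemma risc_unique a (f : nat -> F) : f 0%N = 1 ->
  (forall n, euler f n = a * f n) -> f =1 risc a.
Proof.
move=> f0 fE; elim=> [|n IH]; first by rewrite f0 risc0.
have := fE n; rewrite /euler riscS -IH => /eqP; rewrite subr_eq => /eqP h.
apply: (mulfI (natS_neq0 n)); rewrite h.
by field; rewrite nat1r natS_neq0.
Qed.

Lemma risc_conv a b : conv (risc a) (risc b) =1 risc (a + b).
Proof.
apply: risc_unique => [|n]; first by rewrite /conv big_ord1 !risc0 mulr1.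
rewrite euler_conv (@eq_conv _ (euler (risc a)) (fun i => a * risc a i) _ (risc b)) //.
  rewrite (@eq_conv _ (risc a) (risc a) (euler (risc b)) (fun i => b * risc b i)) //.
    by rewrite convZl convZr mulrDl.
  by move=> i _; exact: euler_risc.
by move=> i _; exact: euler_risc.
Qed.

Lemma risc1 n : risc 1 n = 1 :> F.
Proof.
rewrite -(@risc_unique 1 (fun=> 1)) // => k; rewrite /euler.
by rewrite -[k.+1%:R]natr1; ring.
Qed.

Lemma riscz n : risc 0 n = delta n :> F.
Proof.
rewrite -(@risc_unique 0 (@delta F)) // => k.
by rewrite /euler /delta; case: k => [|k] /=; ring.
Qed.

Lemma conv1 (f : nat -> F) n : conv (risc 1) f n = \sum_(i < n.+1) f i.
Proof. by rewrite convC; apply: eq_bigr => i _; rewrite risc1 mulr1. Qed.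

Lemma risc_gt0 a n : 0 < a -> 0 < risc a n.
Proof.
by move=> a0; apply: prodr_gt0 => j _; rewrite divr_gt0 ?ltr0n// ltr_wpDr.
Qed.

Lemma risc_decr a n m : 0 < a <= 1 -> (n <= m)%N -> risc a m <= risc a n.
Proof.
move=> /andP[a0 a1]; elim: m => [|m IH]; first by rewrite leqn0 => /eqP ->.
rewrite leq_eqVlt => /orP[/eqP->//|/IH]; apply: le_trans.
rewrite riscS ler_piMr ?(ltW (risc_gt0 m a0))//.
by rewrite ler_pdivrMr ?ltr0n// mul1r -(natr1 m) addrC lerD2l.
Qed.

Lemma risc_incr a n m : 1 <= a -> (n <= m)%N -> risc a n <= risc a m.
Proof.
move=> a1; have a0 := lt_le_trans ltr01 a1.
elim: m => [|m IH]; first by rewrite leqn0 => /eqP ->.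
rewrite leq_eqVlt => /orP[/eqP->//|/IH/le_trans]; apply.
rewrite riscS ler_peMr ?(ltW (risc_gt0 m a0))//.
by rewrite ler_pdivlMr ?ltr0n// mul1r -(natr1 m) addrC lerD2r.
Qed.

(** The ratios [(a + n) / (n + 1)] of consecutive coefficients increase with [n]
    when [a <= 1]; this drives the positivity of [wait]. *)
Lemma risc_logconvex a n k : 0 < a <= 1 -> (k <= n)%N ->
  risc a k.+1 * risc a n <= risc a k * risc a n.+1.
Proof.
move=> /andP[a0 a1] kn; rewrite !riscS mulrAC mulrA.
apply: ler_wpM2l; first by rewrite mulr_ge0// ltW// risc_gt0.
rewrite ler_pdivrMr ?ltr0n// mulrAC ler_pdivlMr ?ltr0n//.
have: k%:R <= n%:R :> F by rewrite ler_nat.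
by rewrite -[k.+1%:R]natr1 -[n.+1%:R]natr1; nra.
Qed.

Lemma risc_succ a n : a != 0 -> risc (a + 1) n = risc a n * ((a + n%:R) / a).
Proof.
move=> a0; elim: n => [|n IH]; first by rewrite !risc0 addr0 mulfV// mulr1.
rewrite !riscS IH -[n.+1%:R]natr1; field.
by rewrite a0 natr1 natS_neq0.
Qed.

(** The sum telescopes: [(1 - b) / S_i] is the increment of [(i + 1) / S_i] for
    [S = risc (1 + b)]. *)
Lemma sum_inv_risc b n : 0 < b < 1 ->
  \sum_(i < n.+1) (risc (1 + b) i)^-1 <= n.+1%:R / ((1 - b) * risc (1 + b) n).
Proof.
move=> /andP[b0 b1]; have b'0 : 0 < 1 - b by rewrite subr_gt0.
have pos k : risc (1 + b) k != 0 by rewrite gt_eqF//; apply: risc_gt0; rewrite addr_gt0.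
have eqn : (1 - b) * (\sum_(i < n.+1) (risc (1 + b) i)^-1) =
    n.+1%:R / risc (1 + b) n - b.
  elim: n => [|n IH]; first by rewrite big_ord1 risc0; field.
  have h := pos n; have c : (1 + b + n%:R) != 0.
    by rewrite gt_eqF// ltr_wpDr// addr_gt0.
  rewrite big_ord_recr mulrDr IH /= riscS -[n.+2%:R]natr1 -!natr1.
  field.
  by rewrite h c natr1 natS_neq0.
rewrite invfM mulrA mulrAC ler_pdivlMr// mulrC eqn.
by rewrite gerBl ltW.
Qed.

End RisingCoefficients.

(** * The resolvent of a binomial series *)

Section Resolvent.
Context {F : realFieldType}.
Variables (b l : F).
Hypotheses (b01 : 0 < b < 1) (l0 : 0 <= l).

Let a := risc b.
Let b0 : 0 < b. Proof. by case/andP: b01. Qed.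
Let a_ge0 n : 0 <= a n. Proof. by rewrite ltW// risc_gt0. Qed.
Let l1 : 0 < 1 + l. Proof. by rewrite ltr_pwDl. Qed.
Let l1' : 1 + l != 0. Proof. by rewrite gt_eqF. Qed.

(** The list of the first [n] coefficients, because each coefficient depends on
    all the previous ones. *)
Fixpoint wait_seq (n : nat) : seq F :=
  if n is m.+1 then
    rcons (wait_seq m)
      ((l * risc b m - l * \sum_(i < m) (wait_seq m)`_i * risc b (m - i)%N) / (1 + l))
  else [::].

(** The coefficients of [l A / (1 + l A)] where [A = (1 - z)^(- b)].  They form
    a subprobability on the integers, a waiting-time law, of which [surv] is
    the survival function. *)
Definition wait (n : nat) : F := (wait_seq n.+1)`_n.

Lemma size_wait_seq n : size (wait_seq n) = n.
Proof. by elim: n => //= n IH; rewrite size_rcons IH. Qed.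

Lemma nth_wait_seq n m : (n < m)%N -> (wait_seq m)`_n = wait n.
Proof.
elim: m => // m IH; rewrite ltnS leq_eqVlt => /orP[/eqP->//|nm].
by rewrite /= nth_rcons size_wait_seq nm IH.
Qed.

Lemma wait_rec n :
  (1 + l) * wait n = l * a n - l * \sum_(i < n) wait i * a (n - i)%N.
Proof.
rewrite {1}/wait /= nth_rcons size_wait_seq ltnn eqxx mulrC divfK//.
by under eq_bigr => i _ do rewrite nth_wait_seq//.
Qed.

Lemma wait_eq n : wait n + l * conv a wait n = l * a n.
Proof.
rewrite convC /conv big_ord_recr /= subnn /a risc0 mulr1.
by have := wait_rec n; rewrite /a; lra.
Qed.

(** The coefficients of [(1 - z)^(- 1) / (1 + l A)]. *)
Definition surv (n : nat) : F := 1 - \sum_(i < n.+1) wait i.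

(** The coefficients of [1 / (1 + l A)]. *)
Definition resolvent (n : nat) : F := delta n - wait n.

Lemma surv_resolvent n : surv n = conv (risc 1) resolvent n.
Proof.
rewrite conv1 sumrB; congr (_ - _).
by rewrite (bigD1 ord0)//= big1 ?addr0// => i; rewrite -val_eqE /delta /= => /negbTE ->.
Qed.

Lemma resolvent_eq n : resolvent n + l * conv a resolvent n = delta n.
Proof.
rewrite /resolvent convBr (convC a delta) conv_delta.
by have := wait_eq n; lra.
Qed.

Lemma wait_resolvent n : wait n = l * conv a resolvent n.
Proof. by have := resolvent_eq n; rewrite {1}/resolvent; lra. Qed.

Lemma surv_eq n : surv n + l * conv a surv n = 1.
Proof.
rewrite (@eq_conv _ a a surv (conv (risc 1) resolvent))//; last first.
  by move=> i _; rewrite surv_resolvent.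
rewrite convA (@eq_conv _ _ (conv (risc 1) a) resolvent resolvent)//; last first.
  by move=> i _; rewrite convC.
rewrite -convA surv_resolvent -convZr -convDr.
rewrite (@eq_conv _ _ (risc 1) _ delta)//; last by move=> i _; exact: resolvent_eq.
by rewrite convC conv_delta risc1.
Qed.

(** Kaluza's argument: the renewal equation at [n + 1], minus [a_(n+1) / a_n]
    times the one at [n], expresses [wait n.+1] with nonnegative weights, by
    log-convexity of [a]. *)
Lemma wait_ge0 n : 0 <= wait n.
Proof.
elim/ltn_ind: n => -[_|n IH].
  have := wait_rec 0; rewrite big_ord0 mulr0 subr0 /a risc0 mulr1 => h.
  by rewrite -(pmulr_rge0 _ l1) h.
rewrite -(pmulr_rge0 _ l1) -(pmulr_rge0 _ (risc_gt0 n b0)).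
rewrite wait_rec.
have e : l * a n = wait n + l * \sum_(i < n.+1) wait i * a (n - i)%N.
  by rewrite -wait_eq convC.
have -> : risc b n * (l * a n.+1 - l * \sum_(i < n.+1) wait i * a (n.+1 - i)%N) =
  a n.+1 * wait n + l * \sum_(i < n.+1) wait i *
     (a n.+1 * a (n - i)%N - a n * a (n.+1 - i)%N).
  under [in RHS]eq_bigr => i _ do rewrite mulrBr !(mulrCA (wait i)).
  rewrite sumrB -!mulr_sumr; move: e; rewrite /a.
  move: (\sum_(i < n.+1) _) (\sum_(i < n.+1) _) => s' s e.
  have -> : risc b n * (l * risc b n.+1 - l * s') =
    (l * risc b n) * risc b n.+1 - l * risc b n * s' by ring.
  by rewrite {1}e; ring.
rewrite addr_ge0 ?mulr_ge0 ?IH// sumr_ge0// => -[i /= i_n] _.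
rewrite mulr_ge0 ?IH// subr_ge0 subSn//.
rewrite mulrC [leRHS]mulrC; apply: risc_logconvex; last exact: leq_subr.
by case/andP: b01 => -> /ltW ->.
Qed.

Lemma surv_decr n m : (n <= m)%N -> surv m <= surv n.
Proof.
elim: m => [|m IH]; first by rewrite leqn0 => /eqP ->.
rewrite leq_eqVlt => /orP[/eqP->//|/IH h]; apply: le_trans h.
by rewrite /surv big_ord_recr /=; have := wait_ge0 m.+1; lra.
Qed.

Lemma survS n : surv n.+1 = surv n - wait n.+1.
Proof. by rewrite /surv big_ord_recr/= opprD addrA. Qed.

Lemma surv_le1 n : surv n <= 1.
Proof. by rewrite /surv gerBl sumr_ge0// => i _; exact: wait_ge0. Qed.

(** Subtracting the equations [surv_eq] at [n + 1] and [n] leaves nonnegative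
    weights, because [a] decreases. *)
Lemma surv_ge0 n : 0 <= surv n.
Proof.
elim/ltn_ind: n => -[_|n IH].
  rewrite -(pmulr_rge0 _ l1); have := surv_eq 0.
  by rewrite /conv big_ord1 /= /a risc0 mul1r; lra.
have := surv_eq n; rewrite -(surv_eq n.+1) convC (convC a).
rewrite /conv [in RHS]big_ord_recr /= subnn {3}/a risc0 mulr1 => e.
rewrite -(pmulr_rge0 _ l1).
have -> : (1 + l) * surv n.+1 = surv n + l *
    \sum_(i < n.+1) surv i * (a (n - i)%N - a (n.+1 - i)%N).
  by under eq_bigr => i _ do rewrite mulrBr; rewrite sumrB; lra.
rewrite addr_ge0 ?IH// mulr_ge0// sumr_ge0// => -[i /= i_n] _.
rewrite mulr_ge0 ?IH// subr_ge0 subSn//; apply: risc_decr => //.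
by case/andP: b01 => -> /ltW ->.
Qed.

Lemma surv_upper n : l * risc (1 + b) n * surv n <= 1.
Proof.
rewrite -[leRHS](surv_eq n) -[leLHS]add0r lerD ?surv_ge0//.
rewrite -mulrA ler_wpM2l// -risc_conv conv1 mulr_suml.
apply: ler_sum => i _; rewrite ler_wpM2l ?a_ge0//.
by apply: surv_decr; exact: leq_subr.
Qed.

(** [l U / (1 + l A) = W P] because [A W = U], for [W = (1 - z)^(b - 1)]. *)
Lemma surv_lower n : risc (1 - b) n * (1 - surv n) <= l * surv n.
Proof.
have -> : l * surv n = conv (risc (1 - b)) wait n.
  rewrite surv_resolvent (@eq_conv _ (risc 1) (conv (risc (1 - b)) a) resolvent resolvent)//.
    rewrite -convA -convZr; apply: eq_conv => // i _; exact/esym/wait_resolvent.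
  by move=> i _; rewrite risc_conv; congr risc; ring.
rewrite (_ : 1 - surv n = \sum_(i < n.+1) wait i); last by rewrite /surv; ring.
rewrite convC mulr_sumr.
apply: ler_sum => i _; rewrite mulrC ler_wpM2l ?wait_ge0//.
apply: risc_decr; last exact: leq_subr.
by case/andP: b01 => ? ?; rewrite subr_gt0 gerBl; apply/andP; split=> //; exact: ltW.
Qed.

(** With [P = l A / (1 + l A)], the equation [(1 - z) A' = b A] gives
    [(1 - z) P' = b P (1 - P)]. *)
Lemma euler_wait n : euler wait n = b * (wait n - conv wait wait n).
Proof.
have e k : euler wait k + l * conv a (euler wait) k = b * wait k.
  have : euler wait k + l * euler (conv a wait) k = l * euler a k.
    transitivity (k.+1%:R * (wait k.+1 + l * conv a wait k.+1) -
                  k%:R * (wait k + l * conv a wait k)); first by rewrite /euler; ring.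
    by rewrite !wait_eq /euler; ring.
  rewrite euler_conv /a euler_risc.
  rewrite (@eq_conv _ (euler (risc b)) (fun i => b * risc b i) wait wait)//.
    have := congr1 (fun x => b * x) (wait_eq k); rewrite convZl /a mulrDr; lra.
  by move=> i _; exact: euler_risc.
have -> : euler wait n = conv resolvent (fun k => b * wait k) n.
  rewrite (@eq_conv _ resolvent resolvent _ (fun k => euler wait k + l * conv a (euler wait) k))//.
  rewrite convDr convZr convA.
  rewrite (@eq_conv _ (conv resolvent a) (conv a resolvent) (euler wait) (euler wait))//.
    rewrite -convZl -convDl -[LHS]conv_delta; apply: eq_conv => // i _.
    exact/esym/resolvent_eq.
  by move=> i _; exact: convC.
by rewrite convZr convBl conv_delta.
Qed.

(** [(n + 1) P_(n+1) = (n + b) P_n - b (P P)_n], and [b <= 1]. *)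
Lemma wait_decr n m : (n <= m)%N -> wait m <= wait n.
Proof.
elim: m => [|m IH]; first by rewrite leqn0 => /eqP ->.
rewrite leq_eqVlt => /orP[/eqP->//|/IH]; apply: le_trans.
have /andP[_ b1] := b01.
have c0 : 0 <= conv wait wait m.
  by apply: sumr_ge0 => i _; rewrite mulr_ge0 ?wait_ge0.
have bc : 0 <= b * conv wait wait m by rewrite mulr_ge0// ltW.
have bw : b * wait m <= wait m by rewrite ler_piMl ?wait_ge0// ltW.
rewrite -(ler_pM2l (ltr0Sn F m)).
have := euler_wait m; rewrite /euler mulrBr -natr1 !mulrDl !mul1r; lra.
Qed.

Lemma surv_increment n k : surv n - surv (n + k) <= k%:R * wait n.
Proof.
elim: k => [|k IH]; first by rewrite addn0 mul0r subrr.
rewrite addnS survS -natr1.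
have := wait_decr (leqW (leq_addr k n)); lra.
Qed.

(** A monotone sequence is controlled by its partial sums. *)
Lemma wait_upper n k : k%:R * wait (n + k) <= surv n.
Proof.
have h j : (j <= k)%N -> j%:R * wait (n + k) <= surv n - surv (n + j).
  elim: j => [|j IH] jk; first by rewrite addn0 mul0r subrr.
  rewrite addnS survS -natr1.
  have := IH (ltnW jk); have : wait (n + k) <= wait (n + j).+1.
    by apply: wait_decr; rewrite -addnS leq_add2l.
  by lra.
by have := h _ (leqnn k); have := surv_ge0 (n + k); lra.
Qed.

Lemma sum_mul_wait m :
  \sum_(s < m.+1) s%:R * wait s = \sum_(i < m) surv i - m%:R * surv m.
Proof.
elim: m => [|m IH]; first by rewrite big_ord1 big_ord0 /=; ring.
by rewrite big_ord_recr IH big_ord_recr /= survS -!natr1; ring.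
Qed.

End Resolvent.

(** * Comparison of two resolvents *)

Section TwoResolvents.
Context {F : realFieldType}.
Variable b : F.
Hypothesis b01 : 0 < b < 1.

Implicit Types l : F.

Let b0 : 0 < b. Proof. by case/andP: b01. Qed.
Let b'0 : 0 < 1 - b. Proof. by case/andP: b01; rewrite subr_gt0. Qed.
Let S := risc (1 + b).
Let S_gt0 n : 0 < S n. Proof. by apply: risc_gt0; rewrite addr_gt0. Qed.

Lemma resolvent_diff l l' n : 0 <= l -> 0 <= l' ->
  l * resolvent b l n - l' * resolvent b l' n =
  (l - l') * conv (resolvent b l) (resolvent b l') n.
Proof.
move=> l0 l'0; set r := resolvent b l; set r' := resolvent b l'.
have e : r n = conv r r' n + l' * conv (risc b) (conv r r') n.
  rewrite -[LHS]conv_delta convC.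
  rewrite (@eq_conv _ r r _ (fun k => r' k + l' * conv (risc b) r' k))//; last first.
    by move=> i _; exact/esym/resolvent_eq.
  rewrite convDr convZr !convA; congr (_ + _ * _).
  by apply: eq_conv => // i _; exact: convC.
have e' : r' n = conv r r' n + l * conv (risc b) (conv r r') n.
  rewrite -[LHS]conv_delta.
  rewrite (@eq_conv _ _ (fun k => r k + l * conv (risc b) r k) r' r')//; last first.
    by move=> i _; exact/esym/resolvent_eq.
  by rewrite convDl convZl convA.
by rewrite e' e; ring.
Qed.

Lemma surv_diff l l' n : 0 <= l -> 0 <= l' ->
  l * surv b l n - l' * surv b l' n =
  (l - l') * conv (surv b l) (resolvent b l') n.
Proof.
move=> l0 l'0; rewrite (@eq_conv _ (surv b l) (conv (risc 1) (resolvent b l))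
  (resolvent b l') (resolvent b l'))//; last by move=> i _; exact: surv_resolvent.
rewrite -convA -[RHS]convZr !surv_resolvent -[l * _]convZr -[l' * _]convZr -convBr.
by apply: eq_conv => // i _; exact: resolvent_diff.
Qed.

Lemma surv_le l n : 0 < l -> surv b l n <= (l * S n)^-1.
Proof.
move=> l0; rewrite -[leRHS]mul1r ler_pdivlMr ?mulr_gt0// mulrC.
exact: surv_upper b01 (ltW l0) n.
Qed.

Lemma sum_surv_le l r : 0 < l -> (0 < r)%N ->
  \sum_(i < r.*2) surv b l i <= r.*2%:R / (l * (1 - b) * S r).
Proof.
move=> l0 r0.
apply: (@le_trans _ _ (\sum_(i < r.*2) l^-1 * (S i)^-1)).
  by apply: ler_sum => i _; rewrite -invfM; exact: surv_le.
rewrite -mulr_sumr -mulrA invfM mulrCA ler_wpM2l ?invr_ge0 ?(ltW l0)//.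
have -> : r.*2 = (r.*2.-1).+1 by lia.
apply: le_trans (sum_inv_risc _ b01) _.
rewrite ler_wpM2l// lef_pV2 ?posrE ?mulr_gt0//.
rewrite ler_wpM2l ?(ltW b'0)//; apply: risc_incr; last by lia.
by rewrite lerDl ltW.
Qed.

(** The product of the two survival functions is split off: what remains are the
    increments of [surv], weighted by [wait]. *)
Lemma conv_surv_resolvent l l' n : 0 <= l -> 0 <= l' ->
  conv (surv b l) (resolvent b l') n = surv b l n * surv b l' n -
  \sum_(s < n.+1) wait b l' s * (surv b l (n - s)%N - surv b l n).
Proof.
move=> l0 l'0; rewrite convC convBl conv_delta.
under [in RHS]eq_bigr => i _ do rewrite mulrBr.
by rewrite sumrB -mulr_suml /conv {4}/surv; ring.
Qed.

(** Of two waiting times [s <= n] and [j <= n] with [s + j > n], one exceeds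
    [n / 2], where [wait] is at most of the order of [surv / n]; the other one
    is averaged against the sum of [surv].  The indices are multiples of 4
    because [n / 2] is halved once more in the bound on [wait]. *)
Lemma conv_surv_resolvent_le l l' r : 0 < l -> 0 < l' -> (0 < r)%N ->
  `|conv (surv b l) (resolvent b l') (r.*2.*2)| <=
  (1 + 4 / (1 - b)) / (l * l' * S r ^+ 2).
Proof.
move=> l0 l'0 r0; have l0' := ltW l0; have l'0' := ltW l'0.
rewrite conv_surv_resolvent//; set n := r.*2.*2; set X := \sum_(s < _) _.
have nr : (r <= n)%N by rewrite /n; lia.
have rR : 0 < r%:R :> F by rewrite ltr0n.
have X0 : 0 <= X.
  apply: sumr_ge0 => s _; rewrite mulr_ge0 ?wait_ge0// subr_ge0 surv_decr//.
  exact: leq_subr.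
have Xle : X <= wait b l r.*2 * (\sum_(i < r.*2) surv b l' i) +
                wait b l' r.*2 * (\sum_(i < r.*2) surv b l i).
  rewrite /X -(big_mkord xpredT (fun s => wait b l' s * (surv b l (n - s)%N - surv b l n))).
  rewrite (@big_cat_nat _ _ _ r.*2.+1)//=; last by rewrite /n; lia.
  (* Short waits [s] are paired with increments of [surv] near [n]; for long
     ones, [wait] itself is small. *)
  apply: lerD.
    apply: (@le_trans _ _ (\sum_(s < r.*2.+1) wait b l r.*2 * (s%:R * wait b l' s))).
      rewrite big_mkord; apply: ler_sum => -[s /= sr] _.
      rewrite [leLHS]mulrC [leRHS]mulrA ler_wpM2r ?wait_ge0// [leRHS]mulrC.
      have {2}-> : n = (n - s + s)%N by rewrite subnK//; rewrite /n; lia.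
      apply: le_trans (surv_increment b01 l0' _ _) _.
      by rewrite ler_wpM2l//; apply: wait_decr => //; rewrite /n; lia.
    rewrite -mulr_sumr ler_wpM2l ?wait_ge0// sum_mul_wait gerBl.
    by rewrite mulr_ge0 ?surv_ge0.
  apply: (@le_trans _ _ (\sum_(r.*2.+1 <= s < n.+1) wait b l' r.*2 * surv b l (n - s)%N)).
    rewrite !big_nat; apply: ler_sum => s /andP[rs sn].
    apply: ler_pM; rewrite ?wait_ge0//.
    - by rewrite subr_ge0 surv_decr//; exact: leq_subr.
    - by apply: wait_decr => //; exact: ltnW.
    - by rewrite gerBl surv_ge0.
  rewrite -mulr_sumr ler_wpM2l ?wait_ge0// big_nat_rev /=.
  rewrite -{1}[r.*2.+1]add0n big_addn (_ : (n.+1 - r.*2.+1)%N = r.*2); last by rewrite /n; lia.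
  rewrite big_mkord; apply: ler_sum => i _.
  by rewrite (_ : (n - _)%N = i)//; move: (ltn_ord i); rewrite /n; lia.
have w l1 : 0 < l1 -> wait b l1 r.*2 <= (r%:R * (l1 * S r))^-1.
  move=> l10; rewrite invfM mulrC ler_pdivlMr// mulrC.
  apply: le_trans (surv_le r l10).
  by have := wait_upper b01 (ltW l10) r r; rewrite addnn.
have XX : X <= 4 / (1 - b) / (l * l' * S r ^+ 2).
  apply: le_trans Xle _.
  apply: le_trans (lerD (ler_pM _ _ (w _ l0) (sum_surv_le l'0 r0))
                        (ler_pM _ _ (w _ l'0) (sum_surv_le l0 r0))) _;
    rewrite ?wait_ge0//; try by apply: sumr_ge0 => i _; exact: surv_ge0.
  rewrite le_eqVlt; apply/orP; left; apply/eqP.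
  rewrite -muln2 natrM; field.
  by rewrite !gt_eqF.
have Y0 : 0 <= surv b l n * surv b l' n by rewrite mulr_ge0 ?surv_ge0.
have YY : surv b l n * surv b l' n <= (l * l' * S r ^+ 2)^-1.
  have -> : (l * l' * S r ^+ 2)^-1 = (l * S r)^-1 * (l' * S r)^-1.
    by field; rewrite !gt_eqF.
  apply: ler_pM; rewrite ?surv_ge0//.
    by apply: le_trans (surv_le r l0); exact: surv_decr.
  by apply: le_trans (surv_le r l'0); exact: surv_decr.
rewrite [leRHS]mulrDl mul1r ler_norml; clear Xle; move: X0 XX Y0 YY.
set Z := (l * l' * S r ^+ 2)^-1; set c := 4 / (1 - b) * Z.
move=> X_ge0 XX Y0 YY.
by apply/andP; split; lra.
Qed.

Lemma surv_diff_le l l' r : 0 < l -> 0 < l' -> (0 < r)%N ->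
  `|l * surv b l r.*2.*2 - l' * surv b l' r.*2.*2| <=
  `|l - l'| * ((1 + 4 / (1 - b)) / (l * l' * S r ^+ 2)).
Proof.
move=> l0 l'0 r0; rewrite (surv_diff _ (ltW l0) (ltW l'0)) normrM ler_wpM2l//.
exact: conv_surv_resolvent_le.
Qed.

(** The geometric expansion of [1 / (1 + l A)], with the remainder kept exact. *)
Lemma surv_expansion l K n : 0 <= l ->
  surv b l n = \sum_(k < K) (- l) ^+ k * risc (1 + b * k%:R) n +
  (- l) ^+ K * conv (risc (b * K%:R)) (surv b l) n.
Proof.
move=> l0; elim: K => [|K IH].
  rewrite big_ord0 mulr0 expr0 mul1r add0r.
  by rewrite (@eq_conv _ _ delta _ (surv b l)) ?conv_delta// => i _; exact: riscz.
rewrite big_ord_recr /= {1}IH -addrA; congr (_ + _).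
rewrite (@eq_conv _ (risc (b * K%:R)) (risc (b * K%:R)) _
  (fun k => risc 1 k - l * conv (risc b) (surv b l) k))//; last first.
  by move=> i _; have := surv_eq b l0 i; rewrite risc1; lra.
rewrite convBr convZr convA risc_conv.
rewrite (@eq_conv _ (conv (risc (b * K%:R)) (risc b)) (risc (b * K.+1%:R))
  (surv b l) (surv b l))//; last first.
  by move=> i _; rewrite risc_conv; congr risc; rewrite -natr1; ring.
by rewrite exprS [1 + _]addrC; ring.
Qed.

Lemma surv_expansion_le l K n : 0 <= l ->
  `|surv b l n - \sum_(k < K) (- l) ^+ k * risc (1 + b * k%:R) n| <=
  l ^+ K * risc (1 + b * K%:R) n.
Proof.
move=> l0; rewrite {1}(surv_expansion K n l0) addrAC subrr add0r.
rewrite normrM normrX normrN (ger0_norm l0).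
rewrite ler_wpM2l ?exprn_ge0//.
have rp k : 0 <= risc (b * K%:R) k.
  case: K => [|K]; first by rewrite mulr0 riscz /delta ler0n.
  by rewrite ltW// risc_gt0// mulr_gt0// ltr0n.
rewrite ger0_norm; last by apply: sumr_ge0 => i _; rewrite mulr_ge0 ?surv_ge0.
rewrite addrC -risc_conv; apply: ler_sum => i _.
by rewrite risc1 ler_wpM2l// surv_le1.
Qed.

End TwoResolvents.

(** * The Gamma function *)

Section GammaFunction.
Context {R : realType}.
Notation mu := (@lebesgue_measure R).
Implicit Types z c t : R.

(** The exponent is that of [Gamma (z + 1)], so that [0 <= z] is the natural range. *)
Definition gamma_kernel z (s : R) : R := s `^ z * expR (- s).

Lemma gamma_kernel_ge0 z s : 0 <= gamma_kernel z s.
Proof. by rewrite mulr_ge0 ?powR_ge0 ?expR_ge0. Qed.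

Lemma measurable_gamma_kernel z (A : set R) : measurable_fun A (gamma_kernel z).
Proof.
apply: measurable_funTS; apply: measurable_funM; first exact: measurable_powR.
by apply: measurableT_comp => //; exact: measurable_funN.
Qed.

Definition gamma_integral z : \bar R := (\int[mu]_(s in `[0%R, +oo[) (gamma_kernel z s)%:E)%E.

Lemma gamma_integral_ge0 z : (0 <= gamma_integral z)%E.
Proof. by apply: integral_ge0 => s _; rewrite lee_fin gamma_kernel_ge0. Qed.

Lemma GammaE z : Gamma z = fine (gamma_integral (z - 1)).
Proof.
rewrite /Gamma /gamma_integral -integral_itv_obnd_cbnd//.
by apply/measurable_EFinP; exact: measurable_gamma_kernel.
Qed.

Lemma continuous_expRN : continuous (fun s : R => expR (- s)).
Proof.
move=> s; apply: (@continuous_comp _ _ _ -%R expR); first exact: opp_continuous.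
exact: continuous_expR.
Qed.

Lemma derive1_NexpRN (s : R) : derive1 (fun s : R => - expR (- s)) s = expR (- s).
Proof.
rewrite derive1_comp// derive1N// derive1_id mulN1r derive1_comp// derive1E.
have /funeqP -> := @derive_expR R.
by rewrite derive1N// derive1_id mulrN1 opprK.
Qed.

Lemma gamma_integral0 : gamma_integral 0 = 1%E.
Proof.
rewrite /gamma_integral; under eq_integral do rewrite /gamma_kernel powRr0 mul1r.
rewrite (@ge0_continuous_FTC2y _ _ (fun x => - expR (- x)) _ 0)//.
- by rewrite oppr0 expR0 EFinN oppeK add0e.
- by apply: continuous_subspaceT; exact: continuous_expRN.
- by rewrite -oppr0; apply: cvgN; exact: cvgr_expR.
- by apply: cvgN; apply/cvg_at_right_filter; exact: continuous_expRN.
- by move=> z _; exact: derive1_NexpRN.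
Qed.

Lemma powR_at_right0 z : 0 <= z -> (fun s : R => s `^ z) @ 0^'+ --> (0 `^ z : R).
Proof.
rewrite le_eqVlt => /predU1P[<-|z0].
  by under eq_fun do rewrite powRr0; rewrite powRr0; exact: cvg_cst.
by rewrite powR0 ?gt_eqF//; exact: powR_cvg0.
Qed.

Lemma continuous_powR (z s : R) : 0 < s -> (fun x : R => x `^ z) @ s --> (s `^ z : R).
Proof.
move=> s0; apply: (differentiable_continuous (f := fun x : R => x `^ z)).
by apply/derivable1_diffP; apply: derivable_powR; rewrite in_itv/= s0.
Qed.

Lemma within_continuous_powR (z c : R) : 0 <= z -> 0 < c ->
  {within `[0, c], continuous (fun s : R => s `^ z)}.
Proof.
move=> z0 c0; apply/continuous_within_itvP => //; split.
- by move=> s; rewrite in_itv/= => /andP[s0 _]; exact: continuous_powR.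
- exact: powR_at_right0.
- by apply: cvg_at_left_filter; exact: continuous_powR.
Qed.

Lemma within_continuousM (A : set R) (f g : R -> R) :
  {within A, continuous f} -> {within A, continuous g} ->
  {within A, continuous (fun x => f x * g x)}.
Proof. by move=> cf cg x; apply: continuousM; [exact: cf|exact: cg]. Qed.

(** Integration by parts on a bounded interval; [1 <= z] makes [s `^ (z - 1)]
    continuous up to 0. *)
Lemma gamma_kernel_parts z c : 1 <= z -> 0 < c ->
  (\int[mu]_(s in `[0%R, c]) (gamma_kernel z s)%:E =
  (- gamma_kernel z c)%:E + z%:E * \int[mu]_(s in `[0%R, c]) (gamma_kernel (z - 1) s)%:E)%E.
Proof.
move=> z1 c0; have z0 : 0 < z by exact: lt_le_trans z1.
have z'0 : 0 <= z - 1 by rewrite subr_ge0.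
rewrite /gamma_kernel (@integration_by_parts R (fun s => s `^ z) (fun s => - expR (- s))
  (fun s => z * s `^ (z - 1)) (fun s => expR (- s)) 0 c)//.
- rewrite powR0 ?gt_eqF// mul0r subr0 mulrN; congr (_ + _)%E.
  rewrite -integralZl//; last first.
    apply: continuous_compact_integrable; first exact: segment_compact.
    apply: within_continuousM; first exact: within_continuous_powR.
    by apply: continuous_subspaceT; exact: continuous_expRN.
  under [X in (- X)%E = _]eq_integral do rewrite mulrN EFinN.
  rewrite integral_ge0N ?oppeK; last first.
    by move=> s _; rewrite lee_fin mulr_ge0 ?expR_ge0// mulr_ge0 ?powR_ge0// ltW.
  by apply: eq_integral => s _; rewrite -EFinM mulrA.
- apply: within_continuousM; last exact: within_continuous_powR.
  by apply: continuous_subspaceT => ?; exact: cst_continuous.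
- split.
  + by move=> s; rewrite in_itv/= => /andP[s0 _]; apply: derivable_powR; rewrite in_itv/= s0.
  + by apply: powR_at_right0; exact: ltW.
  + by apply: cvg_at_left_filter; exact: continuous_powR.
- by move=> s; rewrite in_itv/= => /andP[s0 _]; rewrite powR_derive1// in_itv/= s0.
- by apply: continuous_subspaceT; exact: continuous_expRN.
- split.
  + by move=> s _; exact: ex_derive.
  + by apply/cvg_at_right_filter; apply: cvgN; exact: continuous_expRN.
  + by apply/cvg_at_left_filter; apply: cvgN; exact: continuous_expRN.
- by move=> s _; exact: derive1_NexpRN.
Qed.

Lemma gamma_integral_cvg z :
  ((\int[mu]_(s in `[0%R, n%:R]) (gamma_kernel z s)%:E) @[n --> \oo] --> gamma_integral z)%E.
Proof.
rewrite /gamma_integral itv_bndy_bigcup_BRight; under eq_bigcupr do rewrite add0r.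
apply: ge0_nondecreasing_set_cvg_integral => //.
- move=> m n mn; apply/subsetPset; apply: subset_itvl.
  by rewrite bnd_simp ler_nat.
- by move=> n; apply/measurable_EFinP; exact: measurable_gamma_kernel.
- by move=> n s _; rewrite lee_fin gamma_kernel_ge0.
Qed.

Lemma gamma_kernel_itv_le z c :
  (\int[mu]_(s in `[0%R, c]) (gamma_kernel z s)%:E <= gamma_integral z)%E.
Proof.
apply: ge0_subset_integral => //.
- by apply/measurable_EFinP; exact: measurable_gamma_kernel.
- by move=> s _; rewrite lee_fin gamma_kernel_ge0.
- exact: subset_itvl.
Qed.

Lemma gamma_integral_le z : 1 <= z -> (gamma_integral z <= z%:E * gamma_integral (z - 1))%E.
Proof.
move=> z1; have cz := @gamma_integral_cvg z.
rewrite -(cvg_lim _ cz)//; apply: lime_le; first by apply/cvg_ex; exists (gamma_integral z).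
near=> n; rewrite gamma_kernel_parts//; last by rewrite ltr0n; near: n; exists 1%N.
rewrite -[leRHS]add0e leeD//.
  by rewrite lee_fin oppr_le0 gamma_kernel_ge0.
by rewrite lee_wpmul2l ?gamma_kernel_itv_le// lee_fin (le_trans ler01).
Unshelve. all: by end_near. Qed.

(** Finite for exponents at most 1 because [s `^ z <= 1 + s] there, and then for
    all exponents by [gamma_integral_le]. *)
Lemma gamma_integral_lty z : 0 <= z -> (gamma_integral z < +oo)%E.
Proof.
suff h m : 0 <= z <= m.+1%:R -> (gamma_integral z < +oo)%E.
  move=> z0; apply: (h (Num.truncn z)).
  by rewrite z0 ltW// truncnS_gt.
elim: m z => [|m IH] z /andP[z0 zm].
  apply: (@le_lt_trans _ _ (gamma_integral 0 + gamma_integral 1)%E).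
    rewrite /gamma_integral -ge0_integralD//; last 4 first.
      by move=> s _; rewrite lee_fin gamma_kernel_ge0.
      by apply/measurable_EFinP; exact: measurable_gamma_kernel.
      by move=> s _; rewrite lee_fin gamma_kernel_ge0.
      by apply/measurable_EFinP; exact: measurable_gamma_kernel.
    apply: ge0_le_integral => //.
    - by move=> s _; rewrite lee_fin gamma_kernel_ge0.
    - by apply/measurable_EFinP; exact: measurable_gamma_kernel.
    - by apply: emeasurable_funD; apply/measurable_EFinP; exact: measurable_gamma_kernel.
    - move=> s; rewrite /= in_itv/= andbT => s0.
      rewrite -EFinD lee_fin /gamma_kernel -mulrDl ler_wpM2r ?expR_ge0//.
      rewrite powRr0 powRr1//.
      have [s1|s1] := leP 1 s.
        by rewrite (le_trans (ler1_powR s1 zm))// lerDr.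
      have : s `^ z <= 1 `^ z by rewrite ge0_ler_powR ?nnegrE// ltW.
      by rewrite powR1 => /le_trans; apply; rewrite lerDl.
  have := gamma_integral_le (lexx 1); rewrite subrr gamma_integral0 mule1 => h.
  apply: (@le_lt_trans _ _ (1 + 1)%E); first by rewrite leeD2l.
  by rewrite -EFinD ltry.
have [zm'|zm'] := leP z m.+1%:R; first by apply: IH; rewrite z0.
have z1 : 1 <= z by rewrite (le_trans _ (ltW zm'))// ler1n.
apply: le_lt_trans (gamma_integral_le z1) _.
have := IH (z - 1); rewrite subr_ge0 z1 lerBlDr natr1 zm => /(_ isT) h.
by rewrite lte_mul_pinfty ?lee_fin// ge0_fin_numE// gamma_integral_ge0.
Qed.

Lemma gamma_integral_fin z : 0 <= z -> gamma_integral z \is a fin_num.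
Proof. by move=> z0; rewrite ge0_fin_numE ?gamma_integral_ge0// gamma_integral_lty. Qed.

(** Integration by parts for the exponent [z + 1] bounds the boundary term, and
    gives its decay for the exponent [z]. *)
Lemma gamma_kernel_le z c : 0 <= z -> 0 < c ->
  gamma_kernel z c <= (z + 1) * fine (gamma_integral z) / c.
Proof.
move=> z0 c0; rewrite ler_pdivlMr//.
have -> : gamma_kernel z c * c = gamma_kernel (z + 1) c.
  rewrite /gamma_kernel powRD; last by rewrite (gt_eqF c0) implybT.
  by rewrite powRr1 ?ltW//; ring.
have z1 : 1 <= z + 1 by rewrite lerDr.
have := gamma_kernel_parts z1 c0; rewrite addrK => h.
have : (0 <= \int[mu]_(s in `[0%R, c]) (gamma_kernel (z + 1) s)%:E)%E.
  by apply: integral_ge0 => s _; rewrite lee_fin gamma_kernel_ge0.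
rewrite {}h => h.
have : (0 <= (- gamma_kernel (z + 1) c)%:E + (z + 1)%:E * gamma_integral z)%E.
  apply: le_trans h _; rewrite leeD2l// lee_wpmul2l ?gamma_kernel_itv_le// lee_fin.
  exact: le_trans z1.
rewrite -(fineK (gamma_integral_fin z0)) -EFinM -EFinD lee_fin.
by rewrite addrC subr_ge0.
Qed.

Lemma gamma_integral_rec z : 1 <= z -> gamma_integral z = (z%:E * gamma_integral (z - 1))%E.
Proof.
move=> z1; have z0 := le_trans ler01 z1.
apply/eqP; rewrite eq_le gamma_integral_le//=; apply/lee_addgt0Pr => e e0.
have cz := cvgeZl (y := z%:E) isT (@gamma_integral_cvg (z - 1)).
rewrite -(cvg_lim _ cz)//; apply: lime_le; first by apply/cvg_ex; eexists; exact: cz.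
set C := (z + 1) * fine (gamma_integral z).
near=> n.
have n0 : 0 < n%:R :> R by rewrite ltr0n; near: n; exists 1%N.
have -> : (z%:E * \int[mu]_(s in `[0%R, n%:R]) (gamma_kernel (z - 1) s)%:E =
    \int[mu]_(s in `[0%R, n%:R]) (gamma_kernel z s)%:E + (gamma_kernel z n%:R)%:E)%E.
  by rewrite (gamma_kernel_parts z1 n0) addeAC -EFinD addNr add0e.
rewrite leeD ?gamma_kernel_itv_le// lee_fin (le_trans (gamma_kernel_le z0 n0))//.
rewrite ler_pdivrMr// -ler_pdivrMl//.
near: n; exact: nbhs_infty_ger.
Unshelve. all: by end_near. Qed.

Lemma Gamma1 : Gamma 1 = 1 :> R.
Proof. by rewrite GammaE subrr gamma_integral0. Qed.

Lemma GammaS z : 1 <= z -> Gamma (z + 1) = z * Gamma z.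
Proof.
move=> z1; rewrite !GammaE addrK gamma_integral_rec// fineM// gamma_integral_fin//.
by rewrite subr_ge0.
Qed.

End GammaFunction.

Section GammaInequalities.
Context {R : realType}.
Notation mu := (@lebesgue_measure R).
Implicit Types z c t w : R.

(** Young's inequality for [(s / c) `^ t] and 1. *)
Lemma powR_tangent (s c t : R) : 0 <= s -> 0 < c -> 0 <= t <= 1 ->
  s `^ t <= (1 - t) * c `^ t + t * c `^ (t - 1) * s.
Proof.
move=> s0 c0 /andP[]; rewrite le_eqVlt => /predU1P[<- _|t0].
  by rewrite !powRr0 subr0 mul0r mul0r addr0 mulr1.
rewrite le_eqVlt => /predU1P[->|t1].
  by rewrite subrr mul0r add0r powRr0 !mul1r powRr1.
have t'0 : 0 < 1 - t by rewrite subr_gt0.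
have q0 : 0 <= s / c by rewrite divr_ge0// ltW.
have := @conjugate_powR R ((s / c) `^ t) 1 t^-1 (1 - t)^-1 (powR_ge0 _ _) ler01.
rewrite !invr_gt0 !invrK => /(_ t0 t'0); rewrite addrC subrK => /(_ erefl).
rewrite mulr1 -powRrM mulfV ?gt_eqF// powRr1// powR1 mul1r => h.
have ct : 0 < c `^ t by rewrite powR_gt0.
have -> : s `^ t = c `^ t * (s / c) `^ t.
  by rewrite -powRM ?(ltW c0)// mulrC divfK// gt_eqF.
have -> : c `^ (t - 1) = c `^ t / c.
  by rewrite powRB ?(gt_eqF c0) ?implybT// powRr1// ltW.
have -> : (1 - t) * c `^ t + t * (c `^ t / c) * s = c `^ t * (s / c * t + (1 - t)).
  by field; rewrite gt_eqF.
by rewrite ler_wpM2l// ltW.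
Qed.

Lemma gamma_kernel_tangent z t s c : 0 <= z -> 0 <= t <= 1 -> 0 < c -> 0 <= s ->
  gamma_kernel (z + t) s <=
  (1 - t) * c `^ t * gamma_kernel z s + t * c `^ (t - 1) * gamma_kernel (z + 1) s.
Proof.
move=> z0 /andP[t0 t1] c0 s0; rewrite /gamma_kernel !mulrA -mulrDl ler_wpM2r ?expR_ge0//.
have r0 : 0 <= (1 - t) * c `^ t * s `^ z + t * c `^ (t - 1) * s `^ (z + 1).
  by rewrite addr_ge0// !mulr_ge0 ?powR_ge0// subr_ge0.
have [t00|tp] := eqVneq t 0.
  by rewrite t00 !addr0 subr0 !mul1r powRr0 !mul0r addr0 mul1r.
have [s00|sn] := eqVneq s 0.
  have zt : z + t != 0 by rewrite gt_eqF// ltr_wpDl// lt_def tp.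
  by rewrite [leLHS](_ : _ = 0)// s00 powR0.
rewrite [s `^ (z + t)]powRD ?sn ?implybT// [s `^ (z + 1)]powRD ?sn ?implybT// powRr1//.
have := @powR_tangent s c t s0 c0; rewrite t0 t1 => /(_ isT) h.
have -> : (1 - t) * c `^ t * s `^ z + t * c `^ (t - 1) * (s `^ z * s) =
  s `^ z * ((1 - t) * c `^ t + t * c `^ (t - 1) * s) by ring.
by rewrite ler_wpM2l ?powR_ge0.
Qed.

(** The tangent to the concave function [s `^ t] at [s = w], integrated against
    the kernel of [Gamma w]; [w] is the mean of that kernel. *)
Lemma Gamma_add_le w t : 1 <= w -> 0 <= t <= 1 -> Gamma (w + t) <= w `^ t * Gamma w.
Proof.
move=> w1 t01; have w0 : 0 < w by exact: lt_le_trans w1.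
have z0 : 0 <= w - 1 by rewrite subr_ge0.
have /andP[t0 t1] := t01.
rewrite !GammaE -lee_fin addrAC EFinM !fineK ?gamma_integral_fin//; last by rewrite addr_ge0.
have mg z : measurable_fun (`[0, +oo[%classic : set R) (fun s => (gamma_kernel z s)%:E).
  by apply/measurable_EFinP; exact: measurable_gamma_kernel.
apply: (@le_trans _ _ (\int[mu]_(s in `[0%R, +oo[)
  (((1 - t) * w `^ t)%:E * (gamma_kernel (w - 1) s)%:E +
   (t * w `^ (t - 1))%:E * (gamma_kernel (w - 1 + 1) s)%:E))%E).
  apply: ge0_le_integral => //.
  - by move=> s _; rewrite lee_fin gamma_kernel_ge0.
  - exact: mg.
  - by apply: emeasurable_funD; apply: measurable_funeM; exact: mg.
  - move=> s; rewrite /= in_itv/= andbT => s0.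
    by rewrite -!EFinM -EFinD lee_fin gamma_kernel_tangent.
have c1 : 0 <= (1 - t) * w `^ t by rewrite mulr_ge0 ?powR_ge0// subr_ge0.
have c2 : 0 <= t * w `^ (t - 1) by rewrite mulr_ge0 ?powR_ge0.
rewrite ge0_integralD//; last 4 first.
- by move=> s _; rewrite mule_ge0// lee_fin// gamma_kernel_ge0.
- by apply: measurable_funeM; exact: mg.
- by move=> s _; rewrite mule_ge0// lee_fin// gamma_kernel_ge0.
- by apply: measurable_funeM; exact: mg.
rewrite !ge0_integralZl_EFin//; try exact: mg; try by move=> s _; rewrite lee_fin gamma_kernel_ge0.
rewrite -/(gamma_integral _) -/(gamma_integral _) subrK (gamma_integral_rec w1).
rewrite -(fineK (gamma_integral_fin z0)) -!EFinM -EFinD lee_fin.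
rewrite le_eqVlt; apply/orP; left; apply/eqP.
rewrite powRB ?(gt_eqF w0) ?implybT// powRr1 ?(ltW w0)//; field.
by rewrite gt_eqF.
Qed.

(** The integrand is restricted to the interval from [c] to [c + 1]. *)
Lemma Gamma_lower z c : 0 <= z -> 0 < c -> c `^ z * expR (- (c + 1)) <= Gamma (z + 1).
Proof.
move=> z0 c0; rewrite GammaE addrK -lee_fin fineK ?gamma_integral_fin//.
apply: (@le_trans _ _ (\int[mu]_(s in `[c, (c + 1)%R]) (gamma_kernel z s)%:E)%E).
  apply: (@le_trans _ _ (\int[mu]_(s in `[c, (c + 1)%R]) (c `^ z * expR (- (c + 1)))%:E)%E).
    rewrite integral_cst//= lebesgue_measure_itv/= lte_fin ltrDl ltr01.
    by rewrite -EFinD addrAC subrr add0r mule1.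
  apply: ge0_le_integral => //.
  - by move=> s _; rewrite lee_fin mulr_ge0 ?powR_ge0 ?expR_ge0.
  - by apply/measurable_EFinP; exact: measurable_gamma_kernel.
  - move=> s; rewrite /= in_itv/= => /andP[cs sc]; rewrite lee_fin.
    apply: ler_pM; rewrite ?powR_ge0 ?expR_ge0//.
      by rewrite ge0_ler_powR ?nnegrE ?(ltW c0)// (le_trans (ltW c0)).
    by rewrite ler_expR lerN2.
apply: ge0_subset_integral => //.
- by apply/measurable_EFinP; exact: measurable_gamma_kernel.
- by move=> s _; rewrite lee_fin gamma_kernel_ge0.
- by apply: subset_itv; rewrite bnd_simp// ltW.
Qed.

Lemma Gamma_gt0 z : 1 <= z -> 0 < Gamma z.
Proof.
move=> z1; rewrite -(subrK 1 z); apply: lt_le_trans (Gamma_lower _ ltr01).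
  by rewrite powR1 mul1r expR_gt0.
by rewrite subr_ge0.
Qed.

(** The integrands are dominated by [(1 + s `^ M) expR (- s)] as soon as [M]
    bounds the sequence. *)
Lemma Gamma_cvg (z_ : nat -> R) z : (forall n, 1 <= z_ n) ->
  z_ @ \oo --> z -> Gamma (z_ n) @[n --> \oo] --> Gamma z.
Proof.
move=> z_1 zz.
have z1 : 1 <= z.
  by rewrite -(cvg_lim _ zz)//; apply: limr_ge; [apply/cvg_ex; exists z|exact: nearW].
have [M zM] : exists M, forall n, z_ n <= M.
  have /cvg_seq_bounded[M [_ hM]] : cvgn z_ by apply/cvg_ex; exists z.
  exists (M + 1) => n; apply: le_trans (ler_norm _) _.
  by apply: hM => //; rewrite ltrDl.
have M1 : 1 <= M by rewrite (le_trans _ (zM 0%N)).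
have ig y : 0 <= y -> mu.-integrable `]0, +oo[ (fun s => (gamma_kernel y s)%:E).
  move=> y0; apply: (@integrableS _ _ _ mu `[0, +oo[) => //.
    by apply: subset_itvr; rewrite bnd_simp.
  apply/integrableP; split; first by apply/measurable_EFinP; exact: measurable_gamma_kernel.
  under eq_integral do rewrite gee0_abs ?lee_fin ?gamma_kernel_ge0//.
  exact: gamma_integral_lty.
have iz : (\int[mu]_(s in `]0%R, +oo[) (gamma_kernel (z - 1) s)%:E)%E \is a fin_num.
  by apply: integrable_fin_num => //; apply: ig; rewrite subr_ge0.
apply: fine_cvg; rewrite fineK//.
apply: (@dominated_cvg _ _ _ mu _ _ _ _ 
  (fun s => (gamma_kernel 0 s)%:E + (gamma_kernel M s)%:E)%E) => //.
- by move=> n; apply/measurable_EFinP; exact: measurable_gamma_kernel.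
- move=> s; rewrite /= in_itv/= andbT => s0.
  apply: cvg_EFin; first exact: nearW.
  apply: cvgMr_tmp; rewrite /powR gt_eqF//.
  apply: continuous_cvg; first exact: continuous_expR.
  by apply: cvgMr_tmp; apply: cvgB => //; exact: cvg_cst.
- by apply: integrableD => //; apply: ig => //; exact: le_trans M1.
- move=> n s; rewrite /= in_itv/= andbT => s0.
  rewrite lee_fin ger0_norm ?gamma_kernel_ge0// /gamma_kernel powRr0 -mulrDl ler_wpM2r ?expR_ge0//.
  have [s1|s1] := leP 1 s.
    rewrite (@le_trans _ _ (s `^ M))// ?lerDr// ler_powR//.
    by rewrite lerBlDr (le_trans (zM n))// lerDl.
  have : s `^ (z_ n - 1) <= 1 `^ (z_ n - 1).
    by rewrite ge0_ler_powR ?nnegrE ?subr_ge0// ltW.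
  by rewrite powR1 => /le_trans; apply; rewrite lerDl powR_ge0.
Qed.

End GammaInequalities.

Lemma cvg_near_eq {R : realType} (f g : nat -> R) (l : R) :
  f @ \oo --> l -> (\forall n \near \oo, f n = g n) -> g @ \oo --> l.
Proof. by move=> fl fg; move: fl; apply: cvg_trans; exact: near_eq_cvg. Qed.

(** * The limit formula of Euler *)

Section EulerLimit.
Context {R : realType}.
Implicit Types a t : R.

Lemma Gamma_risc a n : 0 <= a ->
  Gamma (1 + n%:R + a) = Gamma (1 + a) * risc (1 + a) n * Gamma (1 + n%:R).
Proof.
move=> a0; elim: n => [|n IH]; first by rewrite !addr0 risc0 mulr1 Gamma1 mulr1.
have e (c : R) : 1 + n.+1%:R + c = (1 + n%:R + c) + 1 by rewrite -natr1; ring.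
have h (c : R) : 0 <= c -> 1 <= 1 + n%:R + c by move=> c0; rewrite -addrA lerDl addr_ge0.
have e0 : 1 + n.+1%:R = 1 + n%:R + 1 :> R by rewrite -natr1 addrA.
have n1 : 1 <= 1 + n%:R :> R by rewrite lerDl.
rewrite e (GammaS (h _ a0)) IH e0 (GammaS n1) riscS -natr1.
move: (Gamma _) (Gamma _) (risc _ _) => G G' r.
by field; rewrite natr1 pnatr_eq0.
Qed.

Lemma cvg_nat_ratio (c d : R) : (n%:R + c) / (n%:R + d) @[n --> \oo] --> (1 : R).
Proof.
have n0 : \forall n \near \oo, 0 < n%:R :> R by exists 1%N => // n /=; rewrite ltr0n.
have V : (n%:R : R)^-1 @[n --> \oo] --> (0 : R) by exact/(gtr0_cvgV0 n0)/cvgr_idn.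
have h (e : R) : 1 + e * (n%:R : R)^-1 @[n --> \oo] --> (1 : R).
  rewrite -[X in _ --> X]addr0; apply: cvgD; first exact: cvg_cst.
  by rewrite -[X in _ --> X](mulr0 e); exact: cvgMl_tmp.
have L : (1 + c / n%:R) / (1 + d / n%:R) @[n --> \oo] --> (1 / 1 : R).
  by apply: cvgM => //; apply: cvgV => //; exact: oner_neq0.
rewrite invr1 mulr1 in L.
apply: (cvg_near_eq L); near=> n.
have np : 0 < n%:R :> R by near: n; exact: n0.
have nd : 0 < n%:R + d.
  by rewrite -ltrBlDr sub0r; near: n; exact: nbhs_infty_gtr.
have nd' : 1 + d / n%:R != 0.
  have -> : 1 + d / n%:R = (n%:R + d) / n%:R by field; rewrite gt_eqF.
  by rewrite gt_eqF// divr_gt0.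
rewrite /=; field.
by rewrite (gt_eqF nd) (gt_eqF np).
Unshelve. all: by end_near. Qed.

(** [Gamma (1 + t) * risc (1 + t) n] is the ratio [Gamma (1 + n + t) / Gamma (1 + n)],
    which [Gamma_add_le] bounds from above, and also from below when it is
    applied between [1 + n + t] and [2 + n]. *)
Lemma risc_cvg_small t : 0 <= t <= 1 ->
  risc (1 + t) n / n%:R `^ t @[n --> \oo] --> (Gamma (1 + t))^-1.
Proof.
move=> /andP[t0 t1].
have G0 : 0 < Gamma (1 + t) by rewrite Gamma_gt0// lerDl.
suff : Gamma (1 + t) * risc (1 + t) n / n%:R `^ t @[n --> \oo] --> (1 : R).
  move=> L; have {}L := @cvgMl_tmp _ _ _ eventually_filter _ (Gamma (1 + t))^-1 _ L.
  rewrite mulr1 in L; apply: (cvg_near_eq L); apply: nearW => n /=.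
  by rewrite -mulrA mulKf// gt_eqF.
apply: (@squeeze_cvgr _ _ _ _ (fun n => (n%:R + 1) / (n%:R + 2))
                              (fun n => (n%:R + 1) / (n%:R + 0))).
- near=> n.
  have n0 : 0 < n%:R :> R by rewrite ltr0n; near: n; exists 1%N.
  have n1 : 1 <= 1 + n%:R :> R by rewrite lerDl.
  have Gn : 0 < Gamma (1 + n%:R) :> R by exact: Gamma_gt0.
  have nt : 0 < n%:R `^ t :> R by rewrite powR_gt0.
  have q : Gamma (1 + t) * risc (1 + t) n = Gamma (1 + n%:R + t) / Gamma (1 + n%:R).
    by rewrite Gamma_risc// mulfK// gt_eqF.
  rewrite q; apply/andP; split; last first.
    rewrite ler_pdivrMr// ler_pdivrMr//.
    apply: le_trans (Gamma_add_le n1 _) _; first by rewrite t0.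
    rewrite ler_wpM2r ?(ltW Gn)// -ler_pdivrMr// addr0 addrC.
    have -> : (n%:R + 1) `^ t / n%:R `^ t = ((n%:R + 1) / n%:R : R) `^ t.
      by rewrite powRM ?invr_ge0 ?addr_ge0// -[n%:R^-1]powR_inv1// -powRrM mulN1r powRN.
    apply: ler1_powR => //; by rewrite ler_pdivlMr// mul1r lerDl.
  have w1 : 1 <= 1 + n%:R + t by rewrite -addrA lerDl addr_ge0.
  have w0 : 0 < 1 + n%:R + t by exact: lt_le_trans w1.
  have := @Gamma_add_le R (1 + n%:R + t) (1 - t) w1.
  rewrite subr_ge0 t1 gerBl t0 => /(_ isT).
  have -> : 1 + n%:R + t + (1 - t) = 1 + n%:R + 1 by ring.
  rewrite GammaS// => h.
  rewrite (ler_pdivlMr _ _ nt) (ler_pdivlMr _ _ Gn).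
  rewrite -(ler_pM2l (powR_gt0 (1 - t) w0)).
  apply: le_trans h; rewrite [leLHS]mulrA ler_wpM2r ?(ltW Gn)//.
  rewrite powRB ?(gt_eqF w0) ?implybT// powRr1 ?(ltW w0)//.
  have n2 : 0 < n%:R + 2 :> R by rewrite addr_gt0.
  have wt : 0 < (1 + n%:R + t) `^ t by exact: powR_gt0.
  have -> : (1 + n%:R + t) / (1 + n%:R + t) `^ t * ((n%:R + 1) / (n%:R + 2) * n%:R `^ t) =
     (1 + n%:R) * ((1 + n%:R + t) / (n%:R + 2) * (n%:R `^ t / (1 + n%:R + t) `^ t)).
    by field; rewrite !gt_eqF.
  rewrite ler_piMr//.
  rewrite mulr_ile1 ?divr_ge0 ?powR_ge0 ?(ltW w0) ?(ltW n2)//.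
    by rewrite ler_pdivrMr// mul1r; clear -t1; lra.
  rewrite ler_pdivrMr// mul1r ge0_ler_powR ?nnegrE ?(ltW w0)//.
  by rewrite addrAC lerDr addr_ge0.
- exact: cvg_nat_ratio.
- exact: cvg_nat_ratio.
Unshelve. all: by end_near. Qed.

(** Both sides obey the same recursion under [a -> a + 1], which reduces the
    claim to the fractional part of [a]. *)
Lemma risc_cvg a : 0 <= a ->
  risc (1 + a) n / n%:R `^ a @[n --> \oo] --> (Gamma (1 + a))^-1.
Proof.
move=> a0; have /andP[ta at1] := trunc_itv a0.
pose t := a - (Num.truncn a)%:R.
have t01 : 0 <= t <= 1.
  by rewrite subr_ge0 ta/= lerBlDl natr1 ltW.
have -> : a = t + (Num.truncn a)%:R by rewrite subrK.
move: t t01 (Num.truncn a) => {ta at1 a0}t /andP[t0 t1].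
elim=> [|m IH]; first by rewrite addr0; apply: risc_cvg_small; rewrite t0.
set a' := t + m%:R in IH.
have a'0 : 0 < 1 + a' by rewrite ltr_pwDl// addr_ge0.
have -> : t + m.+1%:R = a' + 1 by rewrite -natr1 addrA.
rewrite addrA GammaS; last by rewrite lerDl addr_ge0.
have L := @cvgM _ _ _ eventually_filter _ _ _ _ IH
  (@cvgMl_tmp _ _ _ eventually_filter _ (1 + a')^-1 _ (cvg_nat_ratio (1 + a') 0)).
rewrite mulr1 -invfM [Gamma _ * _]mulrC in L; apply: (cvg_near_eq L); near=> n.
have n0 : 0 < n%:R :> R by rewrite ltr0n; near: n; exists 1%N.
rewrite /= risc_succ ?gt_eqF// [_ `^ (a' + 1)]powRD; last by rewrite (gt_eqF n0) implybT.
rewrite powRr1//.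
by field; rewrite !gt_eqF// powR_gt0.
Unshelve. all: by end_near. Qed.

End EulerLimit.

Lemma ler_dist_approx {R : realFieldType} (x y p q e : R) :
  `|p - q| < e / 4 -> `|x - p| <= e / 4 -> `|y - q| <= e / 4 -> `|x - y| <= e.
Proof.
rewrite !ler_norml !ltr_norml.
by move=> /andP[? ?] /andP[? ?] /andP[? ?]; apply/andP; split; lra.
Qed.

Lemma cvgn_sum {R : realType} (f : nat -> nat -> R) (l : nat -> R) K :
  (forall k, f k @ \oo --> l k) ->
  \sum_(k < K) f k n @[n --> \oo] --> \sum_(k < K) l k.
Proof.
move=> fl; elim: K => [|K IH].
  by under eq_fun do rewrite big_ord0; rewrite big_ord0; exact: cvg_cst.
under eq_fun do rewrite big_ord_recr; rewrite big_ord_recr.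
by apply: cvgD => //; exact: fl.
Qed.

(** * The Mittag-Leffler function as the limit of a scheme *)

Section MittagLeffler.
Context {R : realType}.
Implicit Types b x : R.

Let Gb_gt0 b k : 0 <= b -> 0 < Gamma (b * k%:R + 1).
Proof. by move=> b0; rewrite Gamma_gt0// lerDr mulr_ge0. Qed.

(** [Gamma_lower] at the point [c = (2 X + 1) `^ (b0^-1)], chosen so that
    [c `^ b >= 2 X + 1] for all [b >= b0]. *)
Lemma mittag_leffler_term_le b0 b X x k : 0 < b0 -> b0 <= b -> 0 <= x <= X ->
  x ^+ k / Gamma (b * k%:R + 1) <= expR ((2 * X + 1) `^ b0^-1 + 1) * 2^-1 ^+ k.
Proof.
move=> b00 b0b /andP[x0 xX]; set c := _ `^ _.
have X0 : 0 <= X by exact: le_trans xX.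
have X1 : 1 <= 2 * X + 1 by rewrite lerDr mulr_ge0.
have b0' : 0 <= b by exact: le_trans (ltW b00) b0b.
have c1 : 1 <= c.
  have : 1 `^ b0^-1 <= c.
    by rewrite ge0_ler_powR ?invr_ge0 ?nnegrE ?(ltW b00)// (le_trans ler01).
  by rewrite powR1.
have c0 : 0 < c by exact: lt_le_trans c1.
have bk0 : 0 <= b * k%:R by rewrite mulr_ge0.
rewrite ler_pdivrMr ?Gb_gt0//.
apply: (@le_trans _ _ (expR (c + 1) * 2^-1 ^+ k * (c `^ (b * k%:R) * expR (- (c + 1))))).
  have -> : expR (c + 1) * 2^-1 ^+ k * (c `^ (b * k%:R) * expR (- (c + 1))) =
    2^-1 ^+ k * c `^ (b * k%:R) by rewrite expRN; field; rewrite gt_eqF// expR_gt0.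
  rewrite powRrM powR_mulrn ?powR_ge0// -exprMn.
  rewrite lerXn2r ?nnegrE ?mulr_ge0 ?powR_ge0//.
  apply: (@le_trans _ _ (2^-1 * c `^ b0)).
    by rewrite /c -powRrM mulVf ?gt_eqF// powRr1 ?(le_trans ler01)//; lra.
  by rewrite ler_wpM2l// ler_powR.
by rewrite ler_wpM2l ?mulr_ge0 ?expR_ge0 ?exprn_ge0// Gamma_lower.
Qed.

Lemma geometric_half_cvg0 (C : R) : C * 2^-1 ^+ k @[k --> \oo] --> (0 : R).
Proof.
have L := @cvgMl_tmp _ _ _ eventually_filter _ C _ (@cvg_expr R 2^-1 _).
rewrite mulr0 in L; apply: L.
by rewrite ger0_norm ?invr_ge0// invf_lt1// ltr1n.
Qed.

Variable b : R.
Hypothesis b01 : 0 < b < 1.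
Let b0 : 0 < b. Proof. by case/andP: b01. Qed.

Let err x k := x ^+ k / Gamma (b * k%:R + 1).

Lemma mittag_leffler_term_cvg0 x : 0 <= x -> x ^+ k / Gamma (b * k%:R + 1) @[k --> \oo] --> (0 : R).
Proof.
move=> x0; apply: (squeeze_cvgr _ (cvg_cst 0) (geometric_half_cvg0
  (expR ((2 * x + 1) `^ b^-1 + 1)))).
apply: nearW => k; rewrite mittag_leffler_term_le ?lexx ?x0// andbT.
by rewrite divr_ge0 ?exprn_ge0// ltW// Gb_gt0// ltW.
Qed.

(** The relaxation equation of order [b] and rate [x] on the unit interval, discretised
    with [n] steps of length [n^-1]: [A / n `^ b] replaces the fractional
    integral. *)
Definition scheme x n : R := surv b (x / n%:R `^ b) n.

Lemma scheme_term_cvg x k : 0 <= x ->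
  (x / n%:R `^ b) ^+ k * risc (1 + b * k%:R) n @[n --> \oo] -->
  x ^+ k / Gamma (b * k%:R + 1).
Proof.
move=> x0; have bk0 : 0 <= b * k%:R by rewrite mulr_ge0// ltW.
have L := @cvgMl_tmp _ _ _ eventually_filter _ (x ^+ k) _ (risc_cvg bk0).
rewrite [1 + _]addrC in L; apply: (cvg_near_eq L); apply: nearW => n.
rewrite exprMn exprVn powRrM powR_mulrn ?powR_ge0// [in RHS]addrC.
by ring.
Qed.

Let psum x K := \sum_(k < K) (- x) ^+ k / Gamma (b * k%:R + 1).

Lemma scheme_psum_cvg x K : 0 <= x ->
  \sum_(k < K) (- (x / n%:R `^ b)) ^+ k * risc (1 + b * k%:R) n @[n --> \oo] -->
  psum x K.
Proof.
move=> x0; apply: (@cvgn_sum R (fun k n => (- (x / n%:R `^ b)) ^+ k * risc (1 + b * k%:R) n)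
  (fun k => (- x) ^+ k / Gamma (b * k%:R + 1))) => k.
have L := @cvgMl_tmp _ _ _ eventually_filter _ ((-1) ^+ k) _ (@scheme_term_cvg x k x0).
rewrite mulrA -exprMn mulN1r in L; apply: (cvg_near_eq L); apply: nearW => n.
by rewrite mulrA -exprMn mulN1r.
Qed.

(** The expansions of orders [K] and [L] approximate the same number
    [scheme x n]; their distance passes to the limit. *)
Lemma psum_dist x K L : 0 <= x -> `|psum x K - psum x L| <= err x K + err x L.
Proof.
move=> x0.
pose s K n := \sum_(k < K) (- (x / n%:R `^ b)) ^+ k * risc (1 + b * k%:R) n.
pose t k n := (x / n%:R `^ b) ^+ k * risc (1 + b * k%:R) n.
have c1 : `|s K n - s L n| @[n --> \oo] --> `|psum x K - psum x L|.
  by apply: cvg_norm; apply: cvgB; exact: scheme_psum_cvg.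
have c2 : t K n + t L n @[n --> \oo] --> err x K + err x L.
  by apply: cvgD; exact: scheme_term_cvg.
apply: (ler_cvg_to c1 c2); near=> n.
have l0 : 0 <= x / n%:R `^ b by rewrite divr_ge0 ?powR_ge0.
have h1 := @surv_expansion_le R b b01 _ K n l0.
have h2 := @surv_expansion_le R b b01 _ L n l0.
apply: le_trans (lerD h1 h2); rewrite distrC.
set u := surv _ _ _; have -> : s L n - s K n = (u - s K n) - (u - s L n) by ring.
exact: ler_normB.
Unshelve. all: by end_near. Qed.

Lemma psum_cvg x : 0 <= x -> psum x @ \oo --> mittag_leffler b (- x).
Proof.
move=> x0; rewrite /mittag_leffler.
have -> : psum x = series (fun k => (- x) ^+ k / Gamma (b * k%:R + 1)).
  by apply/funext => K; rewrite /series /= big_mkord.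
apply: normed_cvg.
apply: (@series_le_cvg _ _ (fun k => expR ((2 * x + 1) `^ b^-1 + 1) * 2^-1 ^+ k)).
- by move=> k; exact: normr_ge0.
- by move=> k; rewrite mulr_ge0 ?expR_ge0 ?exprn_ge0.
- move=> k; rewrite /= normrM normrX normrN (ger0_norm x0) gtr0_norm.
    by rewrite mittag_leffler_term_le ?lexx ?x0.
  by rewrite invr_gt0 Gb_gt0// ltW.
- apply: is_cvg_geometric_series.
  by rewrite ger0_norm ?invr_ge0// invf_lt1// ltr1n.
Qed.

(** The limit [L -> oo] in [psum_dist]. *)
Lemma mittag_leffler_psum_le x K : 0 <= x ->
  `|mittag_leffler b (- x) - \sum_(k < K) (- x) ^+ k / Gamma (b * k%:R + 1)| <=
  x ^+ K / Gamma (b * K%:R + 1).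
Proof.
move=> x0; rewrite distrC.
have c1 : `|psum x K - psum x L| @[L --> \oo] --> `|psum x K - mittag_leffler b (- x)|.
  by apply: cvg_norm; apply: cvgB; [exact: cvg_cst|exact: psum_cvg].
have c2 : err x K + err x L @[L --> \oo] --> err x K + 0.
  by apply: cvgD; [exact: cvg_cst|exact: mittag_leffler_term_cvg0].
rewrite addr0 in c2.
by apply: (ler_cvg_to c1 c2); apply: nearW => n; exact: psum_dist.
Qed.

Lemma scheme_cvg x : 0 <= x -> scheme x @ \oo --> mittag_leffler b (- x).
Proof.
move=> x0; apply/cvgrPdist_le => e e0.
have e4 : 0 < e / 4 by rewrite divr_gt0.
have /cvgr0Pnorm_lt/(_ _ e4)[K _ /(_ _ (leqnn K)) hK] := mittag_leffler_term_cvg0 x0.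
have h0 := mittag_leffler_psum_le K x0.
have /cvgrPdist_lt/(_ _ e4) h1 := @scheme_psum_cvg x K x0.
have /cvgrPdist_lt/(_ _ e4) h2 := @scheme_term_cvg x K x0.
near=> n.
have l0 : 0 <= x / n%:R `^ b by rewrite divr_ge0 ?powR_ge0.
have h3 := @surv_expansion_le R b b01 _ K n l0.
have h1' : `|psum x K - \sum_(k < K) (- (x / n%:R `^ b)) ^+ k * risc (1 + b * k%:R) n| < e / 4.
  by near: n; exact: h1.
have h2' : `|x ^+ K / Gamma (b * K%:R + 1) - (x / n%:R `^ b) ^+ K * risc (1 + b * K%:R) n| < e / 4.
  by near: n; exact: h2.
rewrite /scheme; move: h0 h1' h2' h3 hK.
rewrite -/(psum x K) /=.
move: (mittag_leffler b _) (psum x K) (surv _ _ _) (\sum_(k < K) _) (_ / Gamma _) (_ * risc _ _).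
move=> E p s q t t'; rewrite !ler_norml !ltr_norml.
by move=> /andP[? ?] /andP[? ?] /andP[? ?] /andP[? ?] /andP[? ?]; apply/andP; split; lra.
Unshelve. all: by end_near. Qed.

End MittagLeffler.

Lemma cvgn_exp {R : realType} (f : nat -> R) (l : R) k :
  f @ \oo --> l -> f n ^+ k @[n --> \oo] --> l ^+ k.
Proof. exact: continuous_cvg (@exprn_continuous R k l). Qed.

(** * Bounds on the Mittag-Leffler function *)

Section MittagLefflerBounds.
Context {R : realType}.
Variable b : R.
Hypothesis b01 : 0 < b < 1.
Let b0 : 0 < b. Proof. by case/andP: b01. Qed.
Let b1 : b < 1. Proof. by case/andP: b01. Qed.
Let E x := mittag_leffler b (- x).

Let step_ge0 x n : 0 <= x -> 0 <= x / n%:R `^ b.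
Proof. by move=> x0; rewrite divr_ge0// powR_ge0. Qed.

Lemma mittag_leffler_ge0 x : 0 <= x -> 0 <= E x.
Proof.
move=> x0; apply: (ler_cvg_to (cvg_cst (0 : R)) (scheme_cvg b01 x0)).
by apply: nearW => n; apply: surv_ge0 => //; exact: step_ge0.
Qed.

Lemma Gamma_add1_le1 : Gamma (1 + b) <= 1.
Proof.
have b01' : 0 <= b <= 1 by rewrite !ltW.
by have := Gamma_add_le (lexx 1) b01'; rewrite powR1 Gamma1 mulr1.
Qed.

Lemma mittag_leffler_upper x : 0 <= x -> x * E x <= 1.
Proof.
move=> x0; have G0 : 0 < Gamma (1 + b) by rewrite Gamma_gt0// lerDl ltW.
suff : x * E x / Gamma (1 + b) <= 1.
  by rewrite ler_pdivrMr// mul1r => /le_trans; apply; exact: Gamma_add1_le1.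
have L : x * scheme b x n * (risc (1 + b) n / n%:R `^ b) @[n --> \oo] -->
    x * E x * (Gamma (1 + b))^-1.
  apply: cvgM; last exact/risc_cvg/ltW.
  by apply: cvgMl_tmp; exact: scheme_cvg.
apply: (ler_cvg_to L (cvg_cst (1 : R))); apply: nearW => n.
apply: le_trans (surv_upper b01 (step_ge0 n x0) n).
by rewrite /scheme le_eqVlt; apply/orP; left; apply/eqP; ring.
Qed.

Lemma mittag_leffler_lower : {k : R | 0 < k & forall x, 0 <= x -> k <= (x + k) * E x}.
Proof.
have b'0 : 0 < 1 - b by rewrite subr_gt0.
(* The limit of [n `^ b * risc (1 - b) n], the factor in [surv_lower]. *)
exists ((1 - b) / Gamma (1 + (1 - b))).
  by rewrite divr_gt0// Gamma_gt0// lerDl ltW.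
move=> x x0; set k := _ / _.
have Lk : risc (1 - b) n * n%:R `^ b @[n --> \oo] --> k.
  have L : (1 - b) * ((n%:R + 0) / (n%:R + (1 - b))) * (risc (1 + (1 - b)) n / n%:R `^ (1 - b))
     @[n --> \oo] --> (1 - b) * 1 * (Gamma (1 + (1 - b)))^-1.
    apply: cvgM; last exact/risc_cvg/ltW.
    by apply: cvgMl_tmp; exact: cvg_nat_ratio.
  rewrite mulr1 in L; apply: (cvg_near_eq L); near=> n.
  have n0 : 0 < n%:R :> R by rewrite ltr0n; near: n; exists 1%N.
  have nb : 0 < n%:R `^ b :> R by rewrite powR_gt0.
  rewrite [1 + (1 - b)]addrC risc_succ ?gt_eqF//.
  rewrite [_ `^ (1 - b)]powRB ?(gt_eqF n0) ?implybT// powRr1//.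
  field; rewrite !gt_eqF//; by rewrite addr_gt0.
have L1 : risc (1 - b) n * n%:R `^ b * (1 - scheme b x n) @[n --> \oo] --> k * (1 - E x).
  apply: cvgM => //; apply: cvgB; [exact: cvg_cst|exact: scheme_cvg].
have L2 : x * scheme b x n @[n --> \oo] --> x * E x.
  by apply: cvgMl_tmp; exact: scheme_cvg.
suff : k * (1 - E x) <= x * E x by rewrite mulrBr mulr1 mulrDl lerBlDr.
apply: (ler_cvg_to L1 L2); near=> n.
have n0 : 0 < n%:R :> R by rewrite ltr0n; near: n; exists 1%N.
have nb : 0 < n%:R `^ b :> R by rewrite powR_gt0.
have := surv_lower b01 (step_ge0 n x0) n.
rewrite -(ler_pM2l nb) /scheme; set u := surv _ _ _ => h.
have -> : risc (1 - b) n * n%:R `^ b * (1 - u) = n%:R `^ b * (risc (1 - b) n * (1 - u)) by ring.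
by apply: le_trans h _; rewrite mulrA mulrCA mulfV ?gt_eqF// mulr1.
Unshelve. all: by end_near. Qed.

(** The limit of [surv_diff_le] along [n = 4 r].  The factor 16 bounds
    [(4 `^ b) ^+ 2], which comes from comparing [n] with [r]. *)
Lemma mittag_leffler_lipschitz x y : 0 < x -> 0 < y ->
  `|x * E x - y * E y| <= 16 * (1 + 4 / (1 - b)) * `|x^-1 - y^-1|.
Proof.
move=> x0 y0; have b'0 : 0 < 1 - b by rewrite subr_gt0.
have four : (fun r => r.*2.*2) @ \oo --> \oo.
  move=> A [N _ NA]; exists N => // r /= Nr; apply: NA => /=.
  by rewrite (leq_trans Nr)// -!addnn -addnA leq_addr.
have L1 : `|x * scheme b x r.*2.*2 - y * scheme b y r.*2.*2| @[r --> \oo] -->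
    `|x * E x - y * E y|.
  apply: cvg_norm; apply: cvgB; apply: cvgMl_tmp.
    exact: cvg_comp four (scheme_cvg b01 (ltW x0)).
  exact: cvg_comp four (scheme_cvg b01 (ltW y0)).
pose G := Gamma (1 + b); have G0 : 0 < G by rewrite Gamma_gt0// lerDl ltW.
pose C := `|x - y| * (1 + 4 / (1 - b)) * (4 `^ b) ^+ 2 / (x * y).
have LS : (risc (1 + b) r / r%:R `^ b) ^- 2 @[r --> \oo] --> G ^+ 2.
  rewrite -[G]invrK exprVn; apply: cvgV.
    by rewrite expf_neq0// invr_neq0// gt_eqF.
  by apply: cvgn_exp; exact/risc_cvg/ltW.
have L2 : C * (risc (1 + b) r / r%:R `^ b) ^- 2 @[r --> \oo] --> C * G ^+ 2.
  exact: cvgMl_tmp.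
apply: (@le_trans _ _ (C * G ^+ 2)).
  apply: (ler_cvg_to L1 L2); near=> r.
  have r0 : (0 < r)%N by near: r; exists 1%N.
  have rb : 0 < r%:R `^ b :> R by rewrite powR_gt0// ltr0n.
  have nn : r.*2.*2%:R = 4 * r%:R :> R by rewrite -!muln2 !natrM; ring.
  set n := r.*2.*2 in nn *.
  have nb : n%:R `^ b = 4 `^ b * r%:R `^ b :> R by rewrite nn powRM.
  have nb0 : 0 < n%:R `^ b :> R by rewrite nb mulr_gt0// powR_gt0.
  have lx : 0 < x / n%:R `^ b by rewrite divr_gt0.
  have ly : 0 < y / n%:R `^ b by rewrite divr_gt0.
  have S0 : 0 < risc (1 + b) r by rewrite risc_gt0// addr_gt0.
  have h := surv_diff_le b01 lx ly r0.
  rewrite /scheme -/n; rewrite -/n in h.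
  set u := surv _ _ _ in h *; set v := surv _ _ _ in h *.
  have -> : `|x * u - y * v| = n%:R `^ b * `|x / n%:R `^ b * u - y / n%:R `^ b * v|.
    rewrite -{1}(gtr0_norm nb0) -normrM; congr `|_|.
    by field; rewrite gt_eqF.
  apply: le_trans (ler_wpM2l (ltW nb0) h) _.
  rewrite le_eqVlt; apply/orP; left; apply/eqP.
  have -> : `|x / n%:R `^ b - y / n%:R `^ b| = `|x - y| / n%:R `^ b.
    by rewrite -mulrBl normrM normfV (gtr0_norm nb0).
  rewrite /C nb; field.
  by rewrite !gt_eqF// powR_gt0.
have -> : `|x^-1 - y^-1| = `|x - y| / (x * y).
  have -> : x^-1 - y^-1 = (y - x) / (x * y) by field; rewrite !gt_eqF.
  by rewrite normrM distrC [X in _ * X]gtr0_norm ?invr_gt0// mulr_gt0.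
have Gsq : G ^+ 2 <= 1 by rewrite expr_le1// ?Gamma_add1_le1// ltW.
have four_b : (4 `^ b) ^+ 2 <= 16 :> R.
  have -> : 16 = 4 ^+ 2 :> R by ring.
  by rewrite lerXn2r ?nnegrE ?powR_ge0//; apply: ler1_powR; [rewrite ler1n|exact: ltW].
have D0 : 0 <= `|x - y| * (1 + 4 / (1 - b)) / (x * y).
  rewrite !mulr_ge0// ?invr_ge0 ?mulr_ge0 ?(ltW x0) ?(ltW y0)//.
  by rewrite addr_ge0// divr_ge0// ltW.
have -> : C * G ^+ 2 = `|x - y| * (1 + 4 / (1 - b)) / (x * y) * ((4 `^ b) ^+ 2 * G ^+ 2).
  by rewrite /C; ring.
have -> : 16 * (1 + 4 / (1 - b)) * (`|x - y| / (x * y)) =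
  `|x - y| * (1 + 4 / (1 - b)) / (x * y) * (16 * 1) by ring.
by rewrite ler_wpM2l// ler_pM// exprn_ge0// ?powR_ge0// ltW.
Unshelve. all: by end_near. Qed.

End MittagLefflerBounds.

(** The partial sums are continuous in [(b, x)], and the remainders are small
    uniformly for [b >= b0] and bounded [x]. *)
Lemma mittag_leffler_cvg {R : realType} (b0 : R) (b_ x_ : nat -> R) (b x : R) : 0 < b0 ->
  (forall n, b0 <= b_ n < 1) -> b0 <= b < 1 -> (forall n, 0 <= x_ n) -> 0 <= x ->
  b_ @ \oo --> b -> x_ @ \oo --> x ->
  mittag_leffler (b_ n) (- x_ n) @[n --> \oo] --> mittag_leffler b (- x).
Proof.
move=> b00 b_b0 bb x_0 x0 bcvg xcvg.
have [X xX] : exists X, forall n, x_ n <= X.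
  have /cvg_seq_bounded[M [_ hM]] : cvgn x_ by apply/cvg_ex; exists x.
  exists (M + 1) => n; apply: le_trans (ler_norm _) _.
  by apply: hM => //; rewrite ltrDl.
have xX' : x <= X.
  by apply: (ler_cvg_to xcvg (cvg_cst X)); exact: nearW.
apply/cvgrPdist_le => e e0; have e4 : 0 < e / 4 by rewrite divr_gt0.
have /cvgr0Pnorm_lt/(_ _ e4)[K _ /(_ _ (leqnn K)) hK] :=
  geometric_half_cvg0 (expR ((2 * X + 1) `^ b0^-1 + 1)).
have {}hK c y : b0 <= c < 1 -> 0 <= y <= X ->
  `|mittag_leffler c (- y) - \sum_(k < K) (- y) ^+ k / Gamma (c * k%:R + 1)| <= e / 4.
  move=> /andP[c0 c1] y0X; have /andP[y0 _] := y0X.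
  have c01 : 0 < c < 1 by rewrite c1 (lt_le_trans b00).
  apply: le_trans (mittag_leffler_psum_le c01 K y0) _.
  apply: le_trans (mittag_leffler_term_le K b00 c0 y0X) _.
  by apply: le_trans (ler_norm _) _; exact: ltW.
have S : \sum_(k < K) (- x_ n) ^+ k / Gamma (b_ n * k%:R + 1) @[n --> \oo] -->
         \sum_(k < K) (- x) ^+ k / Gamma (b * k%:R + 1).
  apply: (@cvgn_sum R (fun k n => (- x_ n) ^+ k / Gamma (b_ n * k%:R + 1))
    (fun k => (- x) ^+ k / Gamma (b * k%:R + 1))) => k.
  apply: cvgM.
    by apply: cvgn_exp; exact: cvgN.
  have bk (c : R) : b0 <= c -> 1 <= c * k%:R + 1.
    by move=> c0; rewrite lerDr mulr_ge0// (le_trans (ltW b00)).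
  apply: cvgV; first by rewrite gt_eqF// Gamma_gt0// bk//; case/andP: bb.
  apply: Gamma_cvg; first by move=> n; apply: bk; case/andP: (b_b0 n).
  apply: cvgD; last exact: cvg_cst.
  exact: cvgMr_tmp.
have /cvgrPdist_lt/(_ _ e4) S' := S.
near=> n.
have h : `|\sum_(k < K) (- x) ^+ k / Gamma (b * k%:R + 1) -
  \sum_(k < K) (- x_ n) ^+ k / Gamma (b_ n * k%:R + 1)| < e / 4.
  by near: n; exact: S'.
have h1 := hK b x bb; rewrite x0 xX' in h1; have {}h1 := h1 isT.
have h2 := hK (b_ n) (x_ n) (b_b0 n); rewrite x_0 xX in h2; have {}h2 := h2 isT.
exact: ler_dist_approx h h1 h2.
Unshelve. all: by end_near. Qed.

(** * Bounded variation and summation by parts *)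

Section BoundedVariation.
Context {R : realType}.
Implicit Types (v w : nat -> R) (B C : R).

Definition variation_le B w : Prop :=
  (forall n, `|w n| <= B) /\ (forall n, \sum_(i < n) `|w i.+1 - w i| <= B).

Lemma variation_le_ge0 B w : variation_le B w -> 0 <= B.
Proof. by case=> /(_ 0%N) h _; exact: le_trans h. Qed.

Lemma variation_le_le B C w : B <= C -> variation_le B w -> variation_le C w.
Proof. by move=> BC [h1 h2]; split=> n; exact: le_trans BC. Qed.

Lemma eq_variation_le B v w : v =1 w -> variation_le B v -> variation_le B w.
Proof.
move=> vw [h1 h2]; split=> n; first by rewrite -vw.
by under eq_bigr do rewrite -!vw.
Qed.

Lemma variation_leM B C v w : variation_le B v -> variation_le C w ->
  variation_le (2 * B * C) (fun n => v n * w n).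
Proof.
move=> bv bw; have B0 := variation_le_ge0 bv; have C0 := variation_le_ge0 bw.
case: bv bw => v1 v2 [w1 w2]; split=> n.
  rewrite normrM (le_trans (ler_pM _ _ (v1 n) (w1 n)))//.
  by rewrite ler_wpM2r// ler_peMl// ler1n.
apply: (@le_trans _ _ (\sum_(i < n) (B * `|w i.+1 - w i| + C * `|v i.+1 - v i|))).
  apply: ler_sum => i _.
  have -> : v i.+1 * w i.+1 - v i * w i = v i.+1 * (w i.+1 - w i) + w i * (v i.+1 - v i).
    by ring.
  rewrite (le_trans (ler_normD _ _))// !normrM.
  by rewrite lerD// ler_wpM2r.
rewrite big_split /= -!mulr_sumr.
have -> : 2 * B * C = B * C + C * B by ring.
by apply: lerD; apply: ler_wpM2l => //; [exact: w2|exact: v2].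
Qed.

Lemma variation_leZ c B w : variation_le B w -> variation_le (`|c| * B) (fun n => c * w n).
Proof.
move=> [h1 h2]; split=> n; first by rewrite normrM ler_wpM2l.
under eq_bigr do rewrite -mulrBr normrM.
by rewrite -mulr_sumr ler_wpM2l.
Qed.

Lemma variation_le_monotone B w : nondecreasing_seq w \/ nonincreasing_seq w ->
  (forall n, 0 <= w n <= B) -> variation_le B w.
Proof.
move=> mw wB; split=> n.
  by have /andP[w0 w1] := wB n; rewrite ger0_norm.
suff -> : \sum_(i < n) `|w i.+1 - w i| = `|w n - w 0%N|.
  by have := wB n; have := wB 0%N; rewrite ler_norml => /andP[? ?] /andP[? ?];
    apply/andP; split; lra.
case: mw => mw.
  have h m k : (m <= k)%N -> w m <= w k by exact: mw.
  rewrite [RHS]ger0_norm ?subr_ge0 ?h// -(telescope_sumr w)// big_mkord.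
  by apply: eq_bigr => i _; rewrite ger0_norm// subr_ge0 h.
have h m k : (m <= k)%N -> w k <= w m by exact: mw.
rewrite [RHS]ler0_norm ?subr_le0 ?h// -(telescope_sumr w)// big_mkord -sumrN.
by apply: eq_bigr => i _; rewrite ler0_norm// subr_le0 h.
Qed.

Lemma variation_leV B g w : 0 < g -> (forall n, g <= w n) -> variation_le B w ->
  variation_le (g^-1 + B / g ^+ 2) (fun n => (w n)^-1).
Proof.
move=> g0 gw bw; have B0 := variation_le_ge0 bw; case: bw => w1 w2.
have w0 n : 0 < w n by exact: lt_le_trans (gw n).
split=> n.
  rewrite gtr0_norm ?invr_gt0// (@le_trans _ _ g^-1)//.
    by rewrite lef_pV2 ?posrE.
  by rewrite lerDl divr_ge0// exprn_ge0// ltW.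
apply: (@le_trans _ _ (B / g ^+ 2)); last by rewrite lerDr invr_ge0 ltW.
apply: (@le_trans _ _ (\sum_(i < n) `|w i.+1 - w i| / g ^+ 2)); last first.
  by rewrite -mulr_suml ler_wpM2r// invr_ge0 exprn_ge0// ltW.
apply: ler_sum => i _.
have -> : (w i.+1)^-1 - (w i)^-1 = - (w i.+1 - w i) / (w i.+1 * w i).
  by field; rewrite !gt_eqF.
rewrite mulNr normrN normrM ler_wpM2l// gtr0_norm ?invr_gt0 ?mulr_gt0//.
rewrite lef_pV2 ?posrE ?mulr_gt0 ?exprn_gt0//.
by rewrite expr2 ler_pM// ltW.
Qed.

(** Summation by parts against the tails of a convergent series. *)
Lemma abel_tail (r w : nat -> R) (s d : R) B M N : variation_le B w -> (M <= N)%N ->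
  (forall n, (M <= n)%N -> `|\sum_(i < n) r i - s| <= d) ->
  `|\sum_(i < N) r i * w i - \sum_(i < M) r i * w i| <= 3 * B * d.
Proof.
move=> bw MN rd; have B0 := variation_le_ge0 bw; case: bw => w1 w2.
pose p n := \sum_(i < n) r i - s.
have d0 : 0 <= d by exact: le_trans (rd M (leqnn _)).
have E : \sum_(i < N) r i * w i - \sum_(i < M) r i * w i =
    p N * w N - p M * w M - \sum_(M <= i < N) p i.+1 * (w i.+1 - w i).
  rewrite -!(big_mkord xpredT (fun i => r i * w i)) (@big_cat_nat _ _ _ M)//=.
  rewrite [X in X - _]addrC addrK -(telescope_sumr (fun n => p n * w n))// -sumrB.
  apply: eq_bigr => i _; rewrite /p big_ord_recr /=; ring.
rewrite E.
have -> : 3 * B * d = d * B + d * B + d * B by ring.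
rewrite (le_trans (ler_normB _ _))// lerD//.
  rewrite (le_trans (ler_normB _ _))// !normrM lerD// ler_pM//; exact: rd.
apply: (@le_trans _ _ (\sum_(M <= i < N) d * `|w i.+1 - w i|)).
  rewrite (le_trans (ler_norm_sum _ _ _))// !big_nat; apply: ler_sum => i /andP[Mi _].
  by rewrite normrM ler_wpM2r// rd// ltnW.
rewrite -mulr_sumr ler_wpM2l// (le_trans _ (w2 N))//.
rewrite -(big_mkord xpredT (fun i => `|w i.+1 - w i|)) (@big_cat_nat _ _ _ M 0 N)//=.
by rewrite lerDr sumr_ge0.
Qed.

(** Uniformly bounded variation makes the tails small uniformly in [k], so that
    pointwise convergence of the multipliers suffices. *)
Lemma abel_cvg (r w : nat -> R) (W : nat -> nat -> R) B (s L : R) (l : nat -> R) :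
  \sum_(i < n) r i @[n --> \oo] --> s ->
  variation_le B w -> (forall k, variation_le B (W k)) ->
  (forall n, W k n @[k --> \oo] --> w n) ->
  \sum_(i < n) r i * w i @[n --> \oo] --> L ->
  (forall k, \sum_(i < n) r i * W k i @[n --> \oo] --> l k) ->
  l @ \oo --> L.
Proof.
move=> rs bw bW Ww wL Wl; apply/cvgrPdist_le => e e0.
have B0 := variation_le_ge0 bw.
pose d := e / 4 / (3 * B + 1).
have d0 : 0 < d by rewrite !divr_gt0// ltr_wpDl// mulr_ge0.
have dB : 3 * B * d <= e / 4.
  have -> : 3 * B * d = e / 4 * (3 * B / (3 * B + 1)) by rewrite /d; ring.
  rewrite ler_piMr ?divr_ge0 ?(ltW e0)// ler_pdivrMr ?ltr_wpDl ?mulr_ge0//.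
  by rewrite mul1r lerDl.
have /cvgrPdist_le/(_ _ d0)[M _ hM] := rs.
have tail v y : variation_le B v -> \sum_(i < n) r i * v i @[n --> \oo] --> y ->
    `|y - \sum_(i < M) r i * v i| <= e / 4.
  move=> bv vy.
  have L1 : `|\sum_(i < n) r i * v i - \sum_(i < M) r i * v i| @[n --> \oo] -->
            `|y - \sum_(i < M) r i * v i|.
    by apply: cvg_norm; apply: cvgB => //; exact: cvg_cst.
  apply: (ler_cvg_to L1 (cvg_cst (e / 4))); near=> n.
  apply: le_trans dB; apply: (abel_tail (s := s)) => //.
    by near: n; exists M.
  by move=> k Mk; rewrite distrC; exact: hM.
have F : \sum_(i < M) r i * W k i @[k --> \oo] --> \sum_(i < M) r i * w i.
  apply: (@cvgn_sum R (fun i k => r i * W k i) (fun i => r i * w i)) => i.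
  exact: cvgMl_tmp.
have e4 : 0 < e / 4 by rewrite divr_gt0.
have /cvgrPdist_lt/(_ _ e4) F' := F.
near=> k.
have h1 := tail _ _ bw wL; have h2 := tail _ _ (bW k) (Wl k).
have h3 : `|\sum_(i < M) r i * w i - \sum_(i < M) r i * W k i| < e / 4.
  by near: k; exact: F'.
exact: ler_dist_approx h3 h1 h2.
Unshelve. all: by end_near. Qed.

(** The Lipschitz bound in [1 / x] telescopes along an increasing sequence. *)
Lemma variation_le_mittag_leffler b1 b m (x : nat -> R) : 0 < b <= b1 -> b1 < 1 -> 0 < m ->
  (forall n, m <= x n) -> nondecreasing_seq x ->
  variation_le (1 + 16 * (1 + 4 / (1 - b1)) / m) (fun n => x n * mittag_leffler b (- x n)).
Proof.
move=> /andP[b0 bb1] b11 m0 mx ndx.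
have b01 : 0 < b < 1 by rewrite b0 (le_lt_trans bb1).
have x0 n : 0 < x n by exact: lt_le_trans (mx n).
have c0 : 0 <= 16 * (1 + 4 / (1 - b1)) / m.
  by rewrite divr_ge0 ?(ltW m0)// mulr_ge0// addr_ge0// divr_ge0// subr_ge0 ltW.
split=> n.
  rewrite ger0_norm ?mulr_ge0 ?(ltW (x0 n)) ?mittag_leffler_ge0 ?(ltW (x0 n))//.
  by rewrite (le_trans (mittag_leffler_upper b01 (ltW (x0 n))))// lerDl.
apply: (@le_trans _ _ (16 * (1 + 4 / (1 - b1)) / m)); last by rewrite lerDr.
apply: (@le_trans _ _ (\sum_(i < n) 16 * (1 + 4 / (1 - b1)) * ((x i)^-1 - (x i.+1)^-1))).
  apply: ler_sum => i _.
  apply: le_trans (mittag_leffler_lipschitz b01 (x0 _) (x0 _)) _.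
  have xi : x i <= x i.+1 by exact: ndx.
  rewrite distrC ger0_norm; last by rewrite subr_ge0 lef_pV2 ?posrE.
  rewrite ler_wpM2r ?subr_ge0 ?lef_pV2 ?posrE//.
  rewrite ler_wpM2l// lerD2l ler_wpM2l// lef_pV2 ?posrE ?subr_gt0//.
    by rewrite lerD2l lerN2.
  by case/andP: b01.
rewrite -mulr_sumr ler_wpM2l//.
  by rewrite mulr_ge0// addr_ge0// divr_ge0// subr_ge0 ltW.
have -> : \sum_(i < n) ((x i)^-1 - (x i.+1)^-1) = (x 0%N)^-1 - (x n)^-1.
  rewrite -opprB -(telescope_sumr (fun i => (x i)^-1))// big_mkord -sumrN.
  by apply: eq_bigr => i _; rewrite opprB.
rewrite lerBlDr (@le_trans _ _ m^-1)//; first by rewrite lef_pV2 ?posrE.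
by rewrite lerDl invr_ge0 ltW.
Qed.

End BoundedVariation.

(** * The eigenvalues *)

Section Spectrum.
Context {R : realType}.
Implicit Types (p q : R) (M : nat -> R).

Lemma powR_seq_monotone M p : (forall n, 1 <= M n) -> nondecreasing_seq M ->
  nondecreasing_seq (fun n => M n `^ p) \/ nonincreasing_seq (fun n => M n `^ p).
Proof.
move=> M1 ndM; have M0 n : 0 < M n by exact: lt_le_trans (M1 n).
have [p0|p0] := leP 0 p; [left|right] => m n mn.
  by rewrite ge0_ler_powR ?nnegrE ?(ltW (M0 _))//; exact: ndM.
rewrite -(opprK p) [leLHS]powRN [leRHS]powRN lef_pV2 ?posrE ?powR_gt0//.
by rewrite ge0_ler_powR ?nnegrE ?(ltW (M0 _)) ?oppr_ge0 ?(ltW p0)//; exact: ndM.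
Qed.

Lemma powR_le1 (c p : R) : 1 <= c -> p <= 0 -> c `^ p <= 1.
Proof. by move=> c1 p0; rewrite -(powRr0 c) ler_powR. Qed.

Lemma variation_le_powR M p : (forall n, 1 <= M n) -> nondecreasing_seq M -> p <= 0 ->
  variation_le 1 (fun n => M n `^ p).
Proof.
move=> M1 ndM p0; apply: variation_le_monotone; first exact: powR_seq_monotone.
by move=> n; rewrite powR_ge0 powR_le1.
Qed.

(** If [q0 <= p0] the ratio is the product of [1 + M^(q0 - p0)], [M^(p0 - p)] and
    [1 / (1 + M^(q - p))], each of which is bounded and monotone in [n]; the
    ratio itself need not be monotone. *)
Lemma variation_le_powR_ratio M p0 q0 p q : (forall n, 1 <= M n) -> nondecreasing_seq M ->
  p0 <= p -> q0 <= q ->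
  variation_le 8 (fun n => (M n `^ p0 + M n `^ q0) / (M n `^ p + M n `^ q)).
Proof.
move=> M1 ndM; have M0 n : 0 < M n by exact: lt_le_trans (M1 n).
wlog pq : p0 q0 p q / q0 <= p0.
  move=> H pp qq; have [h|/ltW h] := leP q0 p0; first exact: H.
  apply: eq_variation_le (H _ _ _ _ h qq pp) => n.
  by rewrite addrC [X in _ / X]addrC.
move=> pp qq.
have c1 : variation_le 2 (fun n => 1 + M n `^ (q0 - p0)).
  apply: variation_le_monotone.
    by case: (@powR_seq_monotone M (q0 - p0) M1 ndM) => h; [left|right] => m n mn;
      rewrite lerD2l; exact: h.
  move=> n; rewrite addr_ge0 ?powR_ge0//= -[leRHS]/(1 + 1) lerD2l.
  by rewrite powR_le1// subr_le0.
have c2 : variation_le 1 (fun n => M n `^ (p0 - p)).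
  by apply: variation_le_powR => //; rewrite subr_le0.
have c3 : variation_le 1 (fun n => (1 + M n `^ (q - p))^-1).
  have P n : 0 < 1 + M n `^ (q - p) by rewrite ltr_wpDr// powR_ge0.
  apply: variation_le_monotone; last first.
    by move=> n; rewrite invr_ge0 (ltW (P n)) invf_le1//= lerDl powR_ge0.
  by case: (@powR_seq_monotone M (q - p) M1 ndM) => h; [right|left] => m n mn;
    rewrite lef_pV2 ?posrE// lerD2l; exact: h.
have := variation_leM (variation_leM c1 c2) c3.
have -> : 2 * (2 * 2 * 1) * 1 = 8 :> R by ring.
apply: eq_variation_le => n.
rewrite !(powRB (x := M n)) ?(gt_eqF (M0 n)) ?implybT//.
have P r : 0 < M n `^ r by rewrite powR_gt0.
by field; rewrite !gt_eqF ?addr_gt0// ltr_wpDr.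
Qed.

Lemma mu_bar_ge1 n : 1 <= mu_bar n.+1 :> R.
Proof.
rewrite /mu_bar; apply: exprn_ege1; rewrite -[leLHS]mul1r -mulrA ler_pM ?ler1n//.
by rewrite ler_pdivlMr// mul1r pi_ge2.
Qed.

Lemma mu_bar_nd : nondecreasing_seq (fun n => mu_bar n.+1 : R).
Proof.
move=> m n mn; rewrite /mu_bar lerXn2r ?nnegrE//.
- by rewrite !mulr_ge0// pi_ge0.
- by rewrite !mulr_ge0// pi_ge0.
by rewrite -!mulrA ler_wpM2r ?mulr_ge0 ?pi_ge0// ler_nat.
Qed.

Lemma mu_ge1 p q n : 0 <= p -> 0 <= q -> 1 <= mu p q n.+1.
Proof.
move=> p0 q0; rewrite /mu -[leLHS]addr0 lerD ?powR_ge0//.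
rewrite -[leLHS](powRr0 (mu_bar n.+1)); apply: ler_powR; first exact: mu_bar_ge1.
by rewrite divr_ge0.
Qed.

Lemma mu_nd p q : 0 <= p -> 0 <= q -> nondecreasing_seq (fun n => mu p q n.+1).
Proof.
move=> p0 q0 m n mn; have h (r : R) : 0 <= r -> mu_bar m.+1 `^ (r / 2) <= mu_bar n.+1 `^ (r / 2).
  move=> r0; rewrite ge0_ler_powR ?divr_ge0 ?nnegrE ?(le_trans ler01 (mu_bar_ge1 _))//.
  exact: mu_bar_nd.
by rewrite /mu lerD// h.
Qed.

Lemma powR_cvg_exp (c : R) (r_ : nat -> R) (r : R) : 0 < c -> r_ @ \oo --> r ->
  c `^ (r_ n) @[n --> \oo] --> c `^ r.
Proof.
move=> c0 rr; rewrite /powR gt_eqF//.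
apply: continuous_cvg; first exact: continuous_expR.
exact: cvgMr_tmp.
Qed.

Lemma mu_cvg (p_ q_ : nat -> R) p q n : p_ @ \oo --> p -> q_ @ \oo --> q ->
  mu (p_ k) (q_ k) n.+1 @[k --> \oo] --> mu p q n.+1.
Proof.
move=> pp qq; have M0 : 0 < mu_bar n.+1 :> R by exact: lt_le_trans (mu_bar_ge1 n).
by apply: cvgD; apply: powR_cvg_exp => //; exact: cvgMr_tmp.
Qed.

End Spectrum.

(** * The multiplier between two parameters *)

Section Multiplier.
Context {R : realType}.
Variables (b0 b1 al0 al1 ga0 ga1 : R).
Hypotheses (hb0 : 0 < b0) (hb : b0 <= b1) (hb1 : b1 < 1).
Hypotheses (hal0 : 0 < al0) (hga0 : 0 < ga0).
Let box := param_box b0 b1 al0 al1 ga0 ga1.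
Implicit Types a : R * R * R.

(** Eigenvalues are numbered from 1, coefficient sequences from 0. *)
Definition mode a (t : R) (n : nat) : R :=
  mittag_leffler a.1.1 (- (mu a.1.2 a.2 n.+1 * t `^ a.1.1)).

Lemma mode_ref_gt0 s n : 0 < s -> 0 < mode (b0, al0, ga0) s n.
Proof.
move=> s0; rewrite /mode /=.
have b01 : 0 < b0 < 1 by rewrite hb0 (le_lt_trans hb).
have [k k0 hk] := mittag_leffler_lower b01.
set x := mu _ _ _ * _.
have x0 : 0 <= x.
  by rewrite mulr_ge0 ?powR_ge0// (le_trans ler01)// mu_ge1// ltW.
rewrite -(pmulr_rgt0 _ (ltr_wpDl x0 k0)).
exact: lt_le_trans k0 (hk _ x0).
Qed.

(** With [G(x) = x E_b(- x)], the ratio of modes is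
    [(s^b0 / t^b) G(x_n) / G0(x0_n)] times the ratio of eigenvalues; each factor
    has bounded variation, uniformly over the box. *)
Lemma variation_le_mode_ratio (s t : R) : 0 < s -> 0 < t -> exists B,
  forall a, box a -> variation_le B (fun n => mode a t n / mode (b0, al0, ga0) s n).
Proof.
move=> s0 t0.
have b01 : 0 < b0 < 1 by rewrite hb0 (le_lt_trans hb).
have [k k0 hk] := mittag_leffler_lower b01.
(* A lower bound for [t `^ b], hence for all [mu_n t `^ b], uniform in [b]. *)
pose m := Num.min 1 t; have m0 : 0 < m by rewrite lt_min ltr01.
have tb b : b0 <= b <= b1 -> m <= t `^ b.
  move=> /andP[bb bb1]; have b'0 := lt_le_trans hb0 bb.
  have [t1|t1] := leP 1 t.
    rewrite (@le_trans _ _ 1)// ?ge_min ?lexx//.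
    by rewrite -(powRr0 t) ler_powR// ltW.
  rewrite (@le_trans _ _ t)// ?ge_min ?lexx ?orbT//.
  by rewrite ger1_powR ?t0 ?(ltW t1)// ltW// (le_lt_trans bb1).
pose x0 n := mu al0 ga0 n.+1 * s `^ b0.
have sb0 : 0 < s `^ b0 by rewrite powR_gt0.
have x0m n : s `^ b0 <= x0 n by rewrite /x0 ler_peMl ?(ltW sb0)// mu_ge1// ltW.
have x0p n : 0 < x0 n by exact: lt_le_trans (x0m n).
have x0nd : nondecreasing_seq x0.
  by move=> i j ij; rewrite /x0 ler_wpM2r ?(ltW sb0)//; apply: mu_nd => //; exact: ltW.
have bb0 : 0 < b0 <= b1 by rewrite hb0.
have v0 := variation_le_mittag_leffler bb0 hb1 sb0 x0m x0nd.
(* [x E(x) >= k x / (x + k)], and the right-hand side increases with [x]. *)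
pose g := k * s `^ b0 / (s `^ b0 + k).
have g0 : 0 < g by rewrite divr_gt0 ?addr_gt0 ?mulr_gt0.
have g0x n : g <= x0 n * mittag_leffler b0 (- x0 n).
  rewrite /g ler_pdivrMr ?addr_gt0//.
  have := hk _ (ltW (x0p n)); have := x0m n; have := x0p n.
  have := mittag_leffler_ge0 b01 (ltW (x0p n)).
  move: (x0 n) (mittag_leffler _ _) => x E E0 xp sx h.
  have E1 : E * (x * s `^ b0 + k * s `^ b0) <= E * (x * s `^ b0 + k * x).
    by rewrite ler_wpM2l// lerD2l ler_wpM2l// ltW.
  have E2 := ler_wpM2r (ltW sb0) h.
  by move: E1 E2; lra.
have v1 := variation_leV g0 g0x v0; set C := g^-1 + _ in v1.
pose D := 1 + 16 * (1 + 4 / (1 - b1)) / m.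
exists (s `^ b0 / m * (2 * (2 * D * C) * 8)) => -[[b al] ga] [/= bbb /andP[al0al _] /andP[ga0ga _]].
have al_ge0 := le_trans (ltW hal0) al0al; have ga_ge0 := le_trans (ltW hga0) ga0ga.
have mtb := tb _ bbb; have tb0 := lt_le_trans m0 mtb.
have /andP[b0b bb1] := bbb.
pose x n := mu al ga n.+1 * t `^ b.
have mx n : m <= x n by rewrite (le_trans mtb)// ler_peMl ?(ltW tb0)// mu_ge1.
have xnd : nondecreasing_seq x.
  by move=> i j ij; rewrite /x ler_wpM2r ?(ltW tb0)//; exact: mu_nd.
have bbb1 : 0 < b <= b1 by rewrite bb1 (lt_le_trans hb0).
have v2 := variation_le_mittag_leffler bbb1 hb1 m0 mx xnd; rewrite -/D in v2.
have hp : al0 / 2 <= al / 2 by rewrite ler_pM2r.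
have hq : ga0 / 2 <= ga / 2 by rewrite ler_pM2r.
have v3 := variation_le_powR_ratio (@mu_bar_ge1 R) (@mu_bar_nd R) hp hq.
have := variation_leZ (s `^ b0 / t `^ b) (variation_leM (variation_leM v2 v1) v3).
set Bd := 2 * _ * _ => /variation_le_le h.
apply: eq_variation_le (h _ _) => [n|]; last first.
  rewrite (ger0_norm (divr_ge0 (powR_ge0 _ _) (powR_ge0 _ _))).
  apply: ler_wpM2r; first exact: variation_le_ge0 (variation_leM (variation_leM v2 v1) v3).
  by rewrite ler_wpM2l ?(ltW sb0)// lef_pV2 ?posrE.
have E0 := mode_ref_gt0 n s0.
have mu0 : 0 < mu al0 ga0 n.+1 by rewrite (lt_le_trans ltr01)// mu_ge1// ltW.
have mu1 : 0 < mu al ga n.+1 by rewrite (lt_le_trans ltr01)// mu_ge1.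
have cancel (c d y z e e0 : R) : 0 < c -> 0 < d -> 0 < y -> 0 < z -> 0 < e0 ->
    c / d * (y * d * e / (z * c * e0) * (z / y)) = e / e0.
  by move=> ? ? ? ? ?; field; rewrite !gt_eqF.
exact: cancel.
Qed.

End Multiplier.

(** * Existence of minimisers *)

Section SequentialMinimum.
Context {R : realType} {T : pseudoMetricType R}.

Lemma compact_lsc_min (K : set T) (I : T -> R) : compact K -> K !=set0 ->
  (forall x, K x -> 0 <= I x) ->
  (forall (c : nat -> T) p l, (forall n, K (c n)) -> K p ->
     c @ \oo --> p -> I (c n) @[n --> \oo] --> l -> I p <= l) ->
  exists2 p, K p & forall x, K x -> I p <= I x.
Proof.
move=> cK [x0 Kx0] I0 lsc.
have hi : has_inf (I @` K).
  split; first by exists (I x0), x0.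
  by exists 0 => _ [x Kx <-]; exact: I0.
set m := inf (I @` K).
have mI x : K x -> m <= I x by move=> Kx; apply: ge_inf; [case: hi|exists x].
have [a aP] : {a : nat -> T & forall n, K (a n) /\ I (a n) < m + n.+1%:R^-1}.
  apply: (@choice _ _ (fun n y => K y /\ I y < m + n.+1%:R^-1)) => n.
  have n0 : 0 < n.+1%:R^-1 :> R by rewrite invr_gt0.
  have [_ [x Kx <-] Ix] := inf_adherent n0 hi.
  by exists x.
have [|p [Kp clp]] := cK (a @ \oo) (fmap_proper_filter a eventually_filter).
  by exists 0%N => // n _; case: (aP n).
(* A cluster point of a minimising sequence is the limit of a sequence that is
   still minimising. *)
have [c cP] : {c : nat -> T & forall j,
    [/\ K (c j), I (c j) <= m + j.+1%:R^-1 & ball p j.+1%:R^-1 (c j)]}.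
  apply: (@choice _ _ (fun j y => [/\ K y, I y <= m + j.+1%:R^-1 & ball p j.+1%:R^-1 y])) => j.
  have j0 : 0 < j.+1%:R^-1 :> R by rewrite invr_gt0.
  have [|_ [[n /= jn <-] pn]] := clp (a @` [set n | (j <= n)%N]) (ball p j.+1%:R^-1) _
    (nbhsx_ballx p _ j0).
    by exists j => // n jn; exists n.
  exists (a n); have [Kn In] := aP n; split => //.
  rewrite (le_trans (ltW In))// lerD2l lef_pV2 ?posrE//.
  by rewrite ler_nat.
have cp : c @ \oo --> p.
  apply/cvg_ballP => e e0; near=> n.
  have [_ _] := cP n; apply: le_ball.
  by rewrite ltW//; near: n; exact: near_infty_natSinv_lt (PosNum e0).
have Im : I (c n) @[n --> \oo] --> m.
  have L : m + n.+1%:R^-1 @[n --> \oo] --> m + 0.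
    by apply: cvgD; [exact: cvg_cst|exact: cvg_harmonic].
  rewrite addr0 in L.
  apply: (squeeze_cvgr _ (cvg_cst m) L); apply: nearW => n.
  by have [Kn In _] := cP n; rewrite mI.
exists p => // x Kx; apply: le_trans (mI x Kx).
by apply: (lsc c) => // n; case: (cP n).
Unshelve. all: by end_near. Qed.

End SequentialMinimum.

(** * The lemma of Fatou for square norms *)

Section L2Fatou.
Context {R : realType}.
Notation mu := (@lebesgue_measure R).
Implicit Types (A : set R) (v w : R -> R).

Lemma L2B A v w : measurable A -> L2 A v -> L2 A w -> L2 A (fun x => v x - w x).
Proof.
move=> mA [mv iv] [mw iw].
have mvw : measurable_fun A (fun x => v x - w x) by exact: measurable_funB.
split=> //.
have i2 : mu.-integrable A (fun x => 2%:E * (v x ^+ 2)%:E + 2%:E * (w x ^+ 2)%:E)%E.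
  by apply: integrableD => //; exact: integrableZl.
apply: le_integrable i2 => //.
  by apply/measurable_EFinP; exact: measurable_funX.
move=> x _; rewrite -!EFinM -EFinD !abse_EFin lee_fin.
rewrite !ger0_norm; [|by rewrite addr_ge0// mulr_ge0// sqr_ge0|exact: sqr_ge0].
rewrite -subr_ge0 (_ : _ - _ = (v x + w x) ^+ 2) ?sqr_ge0//; ring.
Qed.

Lemma L2_norm_sqr A v : measurable A -> L2 A v ->
  (L2_norm A v ^+ 2)%:E = (\int[mu]_(x in A) (v x ^+ 2)%:E)%E.
Proof.
move=> mA [mv iv].
rewrite /L2_norm /L2_inner sqr_sqrtr; last by apply: Rintegral_ge0 => x _; exact: sqr_ge0.
by rewrite /Rintegral fineK// integrable_fin_num.
Qed.

(** The exceptional null set is removed from [A], where the lower limit of the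
    integrands is then the integrand of the limit. *)
Lemma L2_norm_fatou A (v_ : nat -> R -> R) v l : measurable A ->
  (forall k, L2 A (v_ k)) -> L2 A v ->
  {ae mu, forall x, A x -> v_ k x @[k --> \oo] --> v x} ->
  L2_norm A (v_ k) ^+ 2 @[k --> \oo] --> l -> L2_norm A v ^+ 2 <= l.
Proof.
move=> mA Lv_ Lv [N [mN N0 subN]] nl.
have mvk w D : L2 A w -> D `<=` A -> measurable_fun D (fun x => (w x ^+ 2)%:E).
  move=> [mw _] DA; apply/measurable_EFinP; apply: measurable_funX.
  exact: measurable_funS mw.
have E w : L2 A w -> (L2_norm A w ^+ 2)%:E = (\int[mu]_(x in A `\` N) (w x ^+ 2)%:E)%E.
  move=> Lw; rewrite L2_norm_sqr// (ge0_negligible_integral mN mA)//.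
    by apply/measurable_EFinP; apply: measurable_funX; case: Lw.
  by move=> x _; rewrite lee_fin sqr_ge0.
have mAN : measurable (A `\` N) by exact: measurableD.
rewrite -lee_fin E//.
have v_0 k x : (A `\` N) x -> (0 <= (v_ k x ^+ 2)%:E)%E by rewrite lee_fin sqr_ge0.
have h := fatou mu mAN (fun k => mvk _ _ (Lv_ k) (@subDsetl _ _ _)) v_0.
have cl : (\int[mu]_(x in A `\` N) (v_ k x ^+ 2)%:E)%E @[k --> \oo] --> l%:E.
  under eq_fun do rewrite -E//.
  by apply: cvg_EFin => //; exact: nearW.
rewrite is_cvg_limn_einfE in h; last by apply/cvg_ex; exists l%:E.
rewrite (cvg_lim _ cl)// in h; apply: le_trans h.
rewrite le_eqVlt; apply/orP; left; apply/eqP; apply: eq_integral => x.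
rewrite inE => -[Ax Nx].
have vx : (v_ k x ^+ 2)%:E @[k --> \oo] --> (v x ^+ 2)%:E.
  apply: cvg_EFin; first exact: nearW.
  apply: (@cvgn_exp R (fun k => v_ k x)).
  by move: Ax; apply: contrapT => nAx; apply: Nx; apply: subN.
rewrite is_cvg_limn_einfE; last by apply/cvg_ex; eexists; exact: vx.
by apply/esym/cvg_lim.
Qed.

End L2Fatou.

(** * Continuous dependence on the parameter *)

Section ParameterContinuity.
Context {R : realType}.
Variables (b0 b1 al0 al1 ga0 ga1 : R).
Hypotheses (hb0 : 0 < b0) (hb : b0 <= b1) (hb1 : b1 < 1).
Hypotheses (hal0 : 0 < al0) (hga0 : 0 < ga0).
Let box := param_box b0 b1 al0 al1 ga0 ga1.
Implicit Types a p : R * R * R.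

Lemma mode_cvg (c : nat -> R * R * R) p t n : (forall k, box (c k)) -> box p ->
  0 < t -> c @ \oo --> p -> mode (c k) t n @[k --> \oo] --> mode p t n.
Proof.
move=> bc bp t0 cp.
have c1 : (c k).1 @[k --> \oo] --> p.1 by exact: (cvg_comp _ _ cp cvg_fst).
have c2 : (c k).2 @[k --> \oo] --> p.2 by exact: (cvg_comp _ _ cp cvg_snd).
have c11 : (c k).1.1 @[k --> \oo] --> p.1.1 by exact: (cvg_comp _ _ c1 cvg_fst).
have c12 : (c k).1.2 @[k --> \oo] --> p.1.2 by exact: (cvg_comp _ _ c1 cvg_snd).
have x0 a : box a -> 0 <= mu a.1.2 a.2 n.+1 * t `^ a.1.1.
  move=> [_ /andP[h1 _] /andP[h2 _]]; rewrite mulr_ge0 ?powR_ge0// (le_trans ler01)//.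
  by rewrite mu_ge1// (le_trans (ltW _) h1, le_trans (ltW _) h2).
have bb a : box a -> b0 <= a.1.1 < 1.
  by move=> [/andP[-> h] _ _]; rewrite (le_lt_trans h).
apply: (mittag_leffler_cvg hb0) => //.
- by move=> k; exact: bb.
- exact: bb.
- by move=> k; exact: x0.
- exact: x0.
- by apply: cvgM; [exact: mu_cvg|exact: powR_cvg_exp].
Qed.

(** The only quantitative input on [e] is the convergence of the series at the
    least parameter: eigenvalues grow most slowly there, and all other series
    of modes are multiplied versions of it. *)
Lemma mode_series_cvg (e : nat -> R) (c : nat -> R * R * R) p (s t : R)
  (S L : R) (l : nat -> R) :
  0 < s -> 0 < t -> (forall k, box (c k)) -> box p -> c @ \oo --> p ->
  \sum_(i < n) mode (b0, al0, ga0) s i * e i @[n --> \oo] --> S ->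
  \sum_(i < n) mode p t i * e i @[n --> \oo] --> L ->
  (forall k, \sum_(i < n) mode (c k) t i * e i @[n --> \oo] --> l k) ->
  l @ \oo --> L.
Proof.
move=> s0 t0 bc bp cp cS cL cl.
have [B hB] := variation_le_mode_ratio al1 ga1 hb0 hb hb1 hal0 hga0 s0 t0.
pose W a i := mode a t i / mode (b0, al0, ga0) s i.
have refn0 i : mode (b0, al0, ga0) s i != 0.
  by rewrite gt_eqF// (mode_ref_gt0 hb0 hb hb1).
have WE a : (fun n => \sum_(i < n) mode (b0, al0, ga0) s i * e i * W a i) =
    (fun n => \sum_(i < n) mode a t i * e i).
  apply/funext => n; apply: eq_bigr => i _.
  by rewrite mulrC mulrA /W divfK.
apply: (@abel_cvg _ (fun i => mode (b0, al0, ga0) s i * e i) (W p) (fun k => W (c k))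
  B S L l) => //.
- exact: hB bp.
- by move=> k; exact: hB (bc k).
- by move=> n; apply: cvgMr_tmp; exact: mode_cvg.
- by rewrite WE.
- by move=> k; rewrite WE.
Qed.

End ParameterContinuity.

Section Misfit.
Context {R : realType}.

Lemma expansion_sum (f : R -> R) (a : R * R * R) (t : R) N :
  \sum_(1 <= n < N.+1) expansion_term f a t n 0 =
  \sum_(i < N) mode a t i * (coef f i.+1 * psi i.+1 0).
Proof.
rewrite big_add1 big_mkord; apply: eq_bigr => i _.
by case: a => [[b al] ga]; rewrite /expansion_term /mode /= mulNr mulrA.
Qed.

Lemma param_box_compact (b0 b1 al0 al1 ga0 ga1 : R) :
  compact (param_box b0 b1 al0 al1 ga0 ga1).
Proof.
have -> : param_box b0 b1 al0 al1 ga0 ga1 =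
    (`[b0, b1] `*` `[al0, al1]) `*` `[ga0, ga1].
  apply/seteqP; split => [[[b al] ga] [/= h1 h2 h3]|[[b al] ga] [[/= h1 h2] h3]].
    by split; [split|]; rewrite /= in_itv.
  by move: h1 h2 h3; rewrite /= !in_itv.
by apply: compact_setX; [apply: compact_setX|]; exact: segment_compact.
Qed.

(** The interval has positive measure. *)
Lemma ae_itv_exists (T : R) (P : R -> Prop) : 0 < T ->
  {ae lebesgue_measure, forall t, `]0, T]%classic t -> P t} ->
  exists2 s, 0 < s <= T & P s.
Proof.
move=> T0 [N [mN N0 subN]]; apply: contrapT => nP.
have TN : `]0, T] `<=` N.
  move=> s sT; apply: subN => /= Ps; apply: nP; exists s; last exact: Ps.
  by move: sT; rewrite /= in_itv.
have : (lebesgue_measure (`]0%R, T] : set R) <= lebesgue_measure N)%E.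
  by apply: le_measure; rewrite ?inE.
rewrite N0 lebesgue_measure_itv/= lte_fin T0 -EFinB subr0 lee_fin.
by rewrite leNgt T0.
Qed.

End Misfit.

Theorem theorem3p2 (R : realType) (T b0 b1 al0 al1 ga0 ga1 : R)
  (f phi : R -> R) (u : R * R * R -> R -> R -> R)
  (hT : 0 < T)
  (hb0 : 0 < b0) (hb : b0 <= b1) (hb1 : b1 < 1)
  (hal0 : 0 < al0) (hal : al0 <= al1) (hal1 : al1 < 2)
  (hga0 : 0 < ga0) (hga : ga0 <= ga1) (hga1 : ga1 < 2)
  (hf : L2 Dom f)
  (hfH : forall al ga, al0 <= al <= al1 -> ga0 <= ga <= ga1 -> Hdot al ga f)
  (hphi : L2 `]0, T] phi)
  (* [u a] is the weak solution *)
  (hu : forall a, param_box b0 b1 al0 al1 ga0 ga1 a ->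
     weak_solution T f a (u a))
  (* the weak solution is given by its eigenfunction expansion *)
  (hexp : forall a, param_box b0 b1 al0 al1 ga0 ga1 a ->
     forall t, 0 < t <= T -> L2_series Dom (expansion_term f a t) (u a t))
  (* [a |-> u(a)(., 0)], the value of the series at [x = 0], is a well-defined
     map from the parameter box into [L^2(0, T]] *)
  (hu0 : forall a, param_box b0 b1 al0 al1 ga0 ga1 a ->
     {ae lebesgue_measure, forall t, `]0, T]%classic t ->
        \sum_(1 <= n < N.+1) expansion_term f a t n 0
          @[N --> \oo] --> u a t 0})
  (hu0L2 : forall a, param_box b0 b1 al0 al1 ga0 ga1 a ->
     L2 `]0, T] (fun t => u a t 0)) :
  exists2 astar : R * R * R, param_box b0 b1 al0 al1 ga0 ga1 astar &
    forall a, param_box b0 b1 al0 al1 ga0 ga1 a ->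
      misfit T phi (u astar) <= misfit T phi (u a).
Proof.
have box0 : param_box b0 b1 al0 al1 ga0 ga1 (b0, al0, ga0).
  by split; rewrite /= lexx.
apply: compact_lsc_min.
- exact: param_box_compact.
- by exists (b0, al0, ga0).
- by move=> a _; exact: sqr_ge0.
move=> c p l bc bp cp cl.
(* A time at which the series of the least parameter converges. *)
have [s /andP[s0 _] hs] := ae_itv_exists hT (hu0 _ box0).
have LB a : param_box b0 b1 al0 al1 ga0 ga1 a -> L2 `]0, T] (fun t => u a t 0 - phi t).
  by move=> ba; apply: L2B => //; exact: hu0L2.
apply: (L2_norm_fatou (v_ := fun k t => u (c k) t 0 - phi t)) cl => //.
- by move=> k; exact: LB.
- exact: LB.
have hc : {ae lebesgue_measure, forall t, forall k, `]0, T]%classic t ->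
    \sum_(1 <= n < N.+1) expansion_term f (c k) t n 0 @[N --> \oo] --> u (c k) t 0}.
  by apply/ae_foralln => k; exact: hu0.
have aeF := ae_filter_ringOfSetsType (@lebesgue_measure R).
apply: (@filterS2 _ _ aeF _ _ _ _ (hu0 _ bp) hc) => t hpt hct tT.
apply: cvgB; last exact: cvg_cst.
have t0 : 0 < t by move: tT; rewrite /= in_itv/= => /andP[].
apply: (mode_series_cvg hb0 hb hb1 hal0 hga0 (e := fun i => coef f i.+1 * psi i.+1 0)
  s0 t0 bc bp cp (S := u (b0, al0, ga0) s 0)).
- by under eq_fun do rewrite -expansion_sum.
- by under eq_fun do rewrite -expansion_sum; exact: hpt.
- by move=> k; under eq_fun do rewrite -expansion_sum; exact: hct.
Qed.
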